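(* Let $\Gamma\in\mathcal D_\infty$ be a digraph limit, and let $\mathbf W=(W_{00},W_{01},W_{10},W_{11},w)$ be any quintuple representing $\Gamma$. Then the following are equivalent: (i) $\Gamma\in\mathcal P_\infty$; (ii) $t_{\mathrm{ind}}(F,\Gamma)=0$ for every finite digraph $F$ that is not a poset; (iii) $t_{\mathrm{ind}}(\mathsf C_1,\Gamma)=t_{\mathrm{ind}}(\mathsf C_2,\Gamma)=t_{\mathrm{ind}}(\mathsf C_3,\Gamma)=t_{\mathrm{ind}}(\mathsf P_2,\Gamma)=0$; (iv) $w=0$ a.e., $W_{11}=0$ a.e., and $\{(x,y,z)\in[0,1]^3: W_{10}(x,y)>0,\ W_{10}(y,z)>0,\ W_{10}(x,z)<1\}$ is a Lebesgue null set; (v) there exists a quintuple $\mathbf W'=(W'_{00},W'_{01},W'_{10},W'_{11},w')$ representing $\Gamma$ with $w'=0$, $W'_{11}(x,y)=0$ and $W'_{10}(x,x)=0$ for all $x,y$, and such that $W'_{10}(x,y)>0$ and $W'_{10}(y,z)>0$ imply $W'_{10}(x,z)=1$ for all $x,y,z\in[0,1]$.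
   Context: A digraph has vertex set $V$ and edge set $E\subseteq V\times V$ (loops allowed); $\mathcal D$ is the set of isomorphism classes of finite nonempty digraphs. A poset (nonempty set with strict partial order $<$) is identified with the digraph having an edge $i\to j$ iff $i<j$; $\mathcal P\subset\mathcal D$ denotes the finite posets. For finite digraphs $F,G$: $t(F,G)$ is the proportion of all maps $\varphi:V(F)\to V(G)$ with ($i\to j$ in $F\Rightarrow\varphi(i)\to\varphi(j)$ in $G$); $t_{\mathrm{ind}}(F,G)$ is the proportion of injective maps with ($i\to j$ iff $\varphi(i)\to\varphi(j)$), and $0$ if $|F|>|G|$. Identify $\mathcal D$ with its (injective) image under $G\mapsto((t(F,G))_{F\in\mathcal D},|G|^{-1})\in[0,1]^{\mathcal D}\times[0,1]$, let $\overline{\mathcal D}$ be the closure (product topology), $\mathcal D_\infty=\overline{\mathcal D}\setminus\mathcal D$ (digraph limits); $t(F,\cdot),t_{\mathrm{ind}}(F,\cdot)$ extend continuously. $\overline{\mathcal P}$ is the closure of $\mathcal P$ in $\overline{\mathcal D}$ and $\mathcal P_\infty=\overline{\mathcal P}\setminus\mathcal P$ (poset limits). $\mathsf C_1$: one vertex with a loop; $\mathsf C_2$: two vertices with edges in both directions; $\mathsf C_3$: vertices $1,2,3$ with edges $1\to2,2\to3,3\to1$; $\mathsf P_2$: vertices $1,2,3$ with exactly edges $1\to2,2\to3$. A quintuple $\mathbf W=(W_{00},W_{01},W_{10},W_{11},w)$ consists of measurable $W_{\alpha\beta}:[0,1]^2\to[0,1]$ and $w:[0,1]\to\{0,1\}$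 with $\sum_{\alpha,\beta\in\{0,1\}}W_{\alpha\beta}(x,y)=1$ and $W_{\alpha\beta}(x,y)=W_{\beta\alpha}(y,x)$. It defines a random digraph $G(\infty,\mathbf W)$ on $\mathbb N$ with edge indicators $I_{ij}$: take i.i.d. uniform $X_i\in[0,1]$, set $I_{ii}=w(X_i)$, and for $i<j$ choose $(I_{ij},I_{ji})$ with $\mathbb P(I_{ij}=\alpha,I_{ji}=\beta)=W_{\alpha\beta}(X_i,X_j)$, conditionally independently over pairs. $\mathbf W$ represents $\Gamma\in\mathcal D_\infty$ if $G(\infty,\mathbf W)|_{\{1,\dots,n\}}\to\Gamma$ a.s. in $\overline{\mathcal D}$ (equivalently $t(F,\Gamma)=\mathbb P(F\subseteq G(\infty,\mathbf W))$ for all finite digraphs $F$ on subsets of $\mathbb N$); every $\Gamma\in\mathcal D_\infty$ has such a representing quintuple. *)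

(* Defs.v *)
From HB Require Import structures.
From mathcomp Require Import all_boot all_order all_algebra.
From mathcomp Require Import all_classical all_reals all_analysis.
Unset Printing Implicit Defensive.
Import Order.TTheory GRing.Theory Num.Theory.
Import numFieldNormedType.Exports.
Local Open Scope classical_set_scope.
Local Open Scope ring_scope.

Record digraph := Digraph { dn : nat ; dE : 'I_dn.+1 -> 'I_dn.+1 -> bool }.
Arguments dE : clear implicits.

Definition C1 : digraph := @Digraph 0 (fun _ _ => true).
Definition C2 : digraph := @Digraph 1 (fun i j => i != j).
(* C3: vertices 0,1,2 (= 1,2,3 of the paper), edges 0->1, 1->2, 2->0 *)
Definition C3 : digraph := @Digraph 2 (fun i j => val j == ((val i).+1 %% 3)%N).
Definition P2 : digraph := @Digraph 2 (fun i j => val j == (val i).+1).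
Definition nverts (G : digraph) : nat := (dn G).+1.

Definition is_poset (G : digraph) : Prop :=
  (forall i, ~~ dE G i i) /\ (forall i j k, dE G i j -> dE G j k -> dE G i k).

Notation DPt R := {ptws option digraph -> (R : realType)}.

Section Densities.
Variable R : realType.

Definition is_hom (F G : digraph) (phi : {ffun 'I_(dn F).+1 -> 'I_(dn G).+1}) : bool :=
  [forall i, forall j, dE F i j ==> dE G (phi i) (phi j)].

Definition is_ind_emb (F G : digraph) (phi : {ffun 'I_(dn F).+1 -> 'I_(dn G).+1}) : bool :=
  injectiveb phi && [forall i, forall j, dE F i j == dE G (phi i) (phi j)].

Definition tdens (F G : digraph) : R :=
  (#|[set phi | is_hom F G phi]|)%:R / (#|{: {ffun 'I_(dn F).+1 -> 'I_(dn G).+1}}|)%:R.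

Definition tind (F G : digraph) : R :=
  if (nverts F <= nverts G)%N then
    (#|[set phi | is_ind_emb F G phi]|)%:R
      / (#|[set phi : {ffun 'I_(dn F).+1 -> 'I_(dn G).+1} | injectiveb phi]|)%:R
  else 0.


Definition emb (G : digraph) : DPt R :=
  fun o => match o with Some F => tdens F G | None => (nverts G)%:R^-1 end.

Definition Dset : set (DPt R) := emb @` setT.
Definition Dinf : set (DPt R) := closure Dset `\` Dset.
Definition Pset : set (DPt R) := emb @` is_poset.
Definition Pinf : set (DPt R) := closure Pset `\` Pset.

Definition DF (Gam : DPt R) : set_system digraph :=
  [set P | exists2 U, nbhs Gam U & forall G, U (emb G) -> P G].

Definition tind_lim_is (F : digraph) (Gam : DPt R) (c : R) : Prop :=
  (tind F) @ DF Gam --> c.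

Record quintuple := Quintuple {
  W00 : R -> R -> R; W01 : R -> R -> R; W10 : R -> R -> R; W11 : R -> R -> R;
  qw : R -> R }.

Definition Wab (Q : quintuple) (a b : bool) : R -> R -> R :=
  match a, b with
  | false, false => W00 Q | false, true => W01 Q
  | true, false => W10 Q | true, true => W11 Q end.

Definition I01 : set R := `[0, 1]%classic.
Definition I01sq : set (R * R) := I01 `*` I01.

Definition is_quintuple (Q : quintuple) : Prop :=
  (forall a b, measurable_fun I01sq (fun p : R * R => Wab Q a b p.1 p.2)) /\
  measurable_fun I01 (qw Q) /\
  (forall a b x y, I01 x -> I01 y -> 0 <= Wab Q a b x y <= 1) /\
  (forall x y, I01 x -> I01 y -> \sum_(a : bool) \sum_(b : bool) Wab Q a b x y = 1) /\
  (forall a b x y, I01 x -> I01 y -> Wab Q a b x y = Wab Q b a y x) /\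
  (forall x, I01 x -> qw Q x = 0 \/ qw Q x = 1).

(* P(I_ij >= a, I_ji >= b) given X_i = x, X_j = y *)
Definition pW (Q : quintuple) (a b : bool) (x y : R) : R :=
  \sum_(al : bool | a ==> al) \sum_(be : bool | b ==> be) Wab Q al be x y.

(* conditional probability, given (X_i)_i = s, that F (on vertices 0..|F|-1)
   is contained in G(infty, W) *)
Definition cond_sub (Q : quintuple) (F : digraph) (s : nat -> R) : R :=
  (\prod_(i < (dn F).+1) (if dE F i i then qw Q (s i) else 1)) *
  \prod_(i < (dn F).+1) \prod_(j < (dn F).+1 | (i < j)%N)
      pW Q (dE F i j) (dE F j i) (s i) (s j).

Definition scons (x : R) (s : nat -> R) : nat -> R :=
  fun n => match n with 0%N => x | n'.+1 => s n' end.

Fixpoint iint (n : nat) (f : (nat -> R) -> \bar R) : \bar R :=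
  match n with
  | 0%N => f (fun _ => 0)
  | k.+1 => (\int[lebesgue_measure]_(x in I01) iint k (fun s => f (scons x s)))%E
  end.

(* P(F \subseteq G(infty, W)), X_i i.i.d. uniform on [0,1] *)
Definition prob_sub (Q : quintuple) (F : digraph) : \bar R :=
  iint (dn F).+1 (fun s => (cond_sub Q F s)%:E).

Definition represents (Q : quintuple) (Gam : DPt R) : Prop :=
  is_quintuple Q /\ forall F : digraph, ((Gam (Some F))%:E = prob_sub Q F)%E.
End Densities.

Arguments tdens {R}. Arguments tind {R}. Arguments emb {R}.
Arguments Dset {R}. Arguments Dinf {R}. Arguments Pset {R}. Arguments Pinf {R}.
Arguments DF {R}. Arguments tind_lim_is {R}.
Arguments W00 {R}. Arguments W01 {R}. Arguments W10 {R}. Arguments W11 {R}.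
Arguments qw {R}. Arguments Wab {R}. Arguments I01 {R}. Arguments I01sq {R}.
Arguments is_quintuple {R}. Arguments pW {R}. Arguments cond_sub {R}.
Arguments scons {R}. Arguments iint {R}. Arguments prob_sub {R}.
Arguments represents {R}.

(* Main.v *)
Require Import Defs.
From HB Require Import structures.
From mathcomp Require Import all_boot all_order all_algebra.
From mathcomp Require Import all_classical all_reals all_analysis.
From mathcomp Require Import measurable_realfun ring lra zify.
Import Order.TTheory GRing.Theory Num.Theory.
Import numFieldNormedType.Exports.
Local Open Scope classical_set_scope.
Local Open Scope ring_scope.

(** Every condition is compared with a statement about four homomorphism
    densities: t(C1) = t(C2) = 0 and t(P2) = t(T3), where T3 is the transitive
    triangle. The number of failures of transitivity in G is governed by
    t(P2, G) - t(T3, G), which makes the comparison with induced densities a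
    finite count.

    If these identities hold for a digraph limit, a uniform sample of k
    vertices from a digraph G close to the limit is a poset with probability
    close to 1, and by a second moment bound its densities are close to those
    of G; hence posets approximate the limit.

    For a representing kernel the identities say that the nonnegative function
    p(x,y) p(y,z) (1 - p(x,z)), with p = W10 + W11, has integral 0. To make
    transitivity hold everywhere, the relation W10(x,y) > 0 is replaced by "y
    is a density point of the out-neighbourhood of x and x is a density point
    of the in-neighbourhood of y". Two such arcs x -> y -> z give many u near y
    with W10(x,u) > 0 and W10(u,z) > 0, and a generic such u forces
    W10(x,.) = 1 near z. *)

(** * Averages and sampling *)

(** A digraph close to the limit is not repaired, which would call for a removal lemma; it is
    sampled. The order k + 1 of the sample is fixed first, by the accuracy wanted. Only then is the
    digraph taken so close to the limit that the expected number of violations, at most of order k ^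
    3 times the relevant densities, is at most 1/4. Vertices are drawn with repetition, so the
    digraph may be smaller than the sample. A limit point has one more coordinate, the inverse
    order; it must be shown to vanish before the values 1 / (k + 1) can approximate it. The sum p =
    W10 + W11 appears because a homomorphism density asks only for the presence of arcs. On the
    analytic side, transitivity off a null set of triples says nothing about a given triple, and
    deleting a null set of vertices does not suffice, since the exceptional pairs may meet every
    vertex. The relation itself has to be redefined by a rule insensitive to null sets. *)

Section Average.
Variable R : realType.
Implicit Types T A B C V : finType.

Definition avg T (f : T -> R) : R := (\sum_x f x) / #|T|%:R.

Lemma eq_avg T (f g : T -> R) : f =1 g -> avg T f = avg T g.
Proof. by move=> fg; rewrite /avg; congr (_ / _); apply: eq_bigr. Qed.

Lemma le_avg T (f g : T -> R) : (forall x, f x <= g x) -> avg T f <= avg T g.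
Proof.
by move=> fg; rewrite /avg ler_wpM2r ?invr_ge0// ler_sum.
Qed.

Lemma avg_ge0 T (f : T -> R) : (forall x, 0 <= f x) -> 0 <= avg T f.
Proof. by move=> f0; rewrite /avg divr_ge0// sumr_ge0. Qed.

Lemma avgD T (f g : T -> R) : avg T (fun x => f x + g x) = avg T f + avg T g.
Proof. by rewrite /avg big_split/= mulrDl. Qed.

Lemma avgB T (f g : T -> R) : avg T (fun x => f x - g x) = avg T f - avg T g.
Proof. by rewrite /avg sumrB mulrBl. Qed.

Lemma avgZ T (f : T -> R) c : avg T (fun x => c * f x) = c * avg T f.
Proof. by rewrite /avg -mulr_sumr mulrA. Qed.

Lemma avg_sum T (I : finType) (P : pred I) (f : I -> T -> R) :
  avg T (fun x => \sum_(i | P i) f i x) = \sum_(i | P i) avg T (f i).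
Proof. by rewrite /avg exchange_big/= mulr_suml. Qed.

Lemma avg_const T c : (0 < #|T|)%N -> avg T (fun=> c) = c.
Proof.
by move=> T0; rewrite /avg sumr_const -[c *+ _]mulr_natr mulfK// pnatr_eq0 -lt0n.
Qed.

Lemma exchange_avg T B (f : T -> B -> R) :
  avg T (fun x => avg B (f x)) = avg B (fun y => avg T (f^~ y)).
Proof.
rewrite /avg -!mulr_suml exchange_big/= -!mulrA; congr (_ * _).
by rewrite mulrC.
Qed.

Lemma avg_lt_ex T (f : T -> R) c : avg T f < c -> (0 < #|T|)%N ->
  exists x, f x < c.
Proof.
move=> fc T0; apply: contrapT => /forallNP nf; move: fc; apply/negP.
rewrite -leNgt -[leLHS](avg_const _ c T0); apply: le_avg => x.
by have /negP := nf x; rewrite -leNgt.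
Qed.

(** Restricting a uniform random map along an injection gives a uniform random map: all fibres have
    the same cardinality [K], with one factor [#|V|] for each point outside the image. *)
Lemma avg_comp A B V (e : A -> B) (f : {ffun A -> V} -> R) :
  injective e -> (0 < #|V|)%N ->
  avg {ffun B -> V} (fun psi => f [ffun a => psi (e a)]) = avg _ f.
Proof.
move=> inj_e V0.
pose K := (\prod_(b : B) (if b \in codom e then 1 else #|V|))%N.
have cardK (chi : {ffun A -> V}) :
    #|[pred psi : {ffun B -> V} | [ffun a => psi (e a)] == chi]| = K.
  pose F b := [pred v : V | [forall a, (e a == b) ==> (v == chi a)]].
  have -> : #|[pred psi : {ffun B -> V} | [ffun a => psi (e a)] == chi]|
          = #|family F|.
    apply: eq_card => psi; rewrite inE; apply/eqP/familyP => [psiE b|psiF].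
      by rewrite inE; apply/forallP => a; apply/implyP => /eqP <-; rewrite -psiE ffunE.
    apply/ffunP => a; rewrite ffunE; have := psiF (e a); rewrite inE.
    by move=> /forallP/(_ a); rewrite eqxx => /eqP.
  rewrite card_family foldrE big_map enumT /K; apply: eq_bigr => b _.
  case: ifPn => [/codomP[a ->]|bNe].
    rewrite -(card1 (chi a)); apply: eq_card => v; rewrite !inE.
    apply/forallP/eqP => [/(_ a)|->]; first by rewrite eqxx => /eqP.
    by move=> a'; apply/implyP => /eqP/inj_e ->.
  apply: eq_card => v; rewrite !inE; apply/forallP => a; apply/implyP => /eqP.
  by move=> eab; rewrite -eab codom_f in bNe.
have sumK (g : {ffun A -> V} -> R) :
    \sum_(psi : {ffun B -> V}) g [ffun a => psi (e a)] = K%:R * \sum_chi g chi.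
  rewrite (partition_big (fun psi : {ffun B -> V} => [ffun a => psi (e a)] : {ffun A -> V}) xpredT)//=.
  rewrite mulr_sumr; apply: eq_bigr => chi _.
  rewrite (eq_bigr (fun=> g chi)) => [|psi /eqP <-//].
  by rewrite sumr_const cardK mulr_natl.
have K0 : K%:R != 0 :> R.
  rewrite pnatr_eq0 -lt0n /K; apply: prodn_gt0 => b; case: ifP => //.
have := sumK (fun=> 1); rewrite !sumr_const /avg sumK => ->.
by rewrite -mulf_div divff// mul1r.
Qed.

Lemma avg_pair A B V (u : {ffun A -> V} -> {ffun B -> V} -> R) :
  avg _ (fun phi1 => avg _ (u phi1)) =
  avg {ffun A + B -> V} (fun chi => u [ffun a => chi (inl a)] [ffun b => chi (inr b)]).
Proof.
pose h (p : {ffun A -> V} * {ffun B -> V}) : {ffun A + B -> V} :=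
  [ffun x => match x with inl a => p.1 a | inr b => p.2 b end].
pose h' (chi : {ffun A + B -> V}) : {ffun A -> V} * {ffun B -> V} :=
  ([ffun a => chi (inl a)], [ffun b => chi (inr b)]).
have hK : cancel h h'.
  by move=> [p q]; congr pair; apply/ffunP => x; rewrite !ffunE.
have h'K : cancel h' h.
  by move=> chi; apply/ffunP => -[x|x]; rewrite !ffunE.
rewrite /avg -mulr_suml pair_big/= -mulrA -invfM -natrM; congr (_ / _%:R); last first.
  by rewrite !card_ffun card_sum expnD mulnC.
rewrite [RHS](reindex h)/=; last by exists h' => x _.
apply: eq_bigr => -[p q] _ /=.
by congr u; apply/ffunP => x; rewrite !ffunE.
Qed.

(** The two factors read disjoint sets of coordinates of a uniform random map, hence are
    independent. Injectivity on [A + B] expresses both the disjointness and the injectivity of [e1]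
    and [e2]. *)
Lemma avg_indep A B C V (e1 : A -> C) (e2 : B -> C)
    (g : {ffun A -> V} -> R) (h : {ffun B -> V} -> R) :
  injective (fun x : A + B => match x with inl a => e1 a | inr b => e2 b end) ->
  (0 < #|V|)%N ->
  avg {ffun C -> V}
    (fun psi => g [ffun a => psi (e1 a)] * h [ffun b => psi (e2 b)]) =
  avg _ g * avg _ h.
Proof.
move=> inj V0; set e := fun x => _ in inj.
transitivity (avg {ffun A + B -> V}
    (fun chi => g [ffun a => chi (inl a)] * h [ffun b => chi (inr b)])).
  rewrite -(avg_comp _ _ _ e)//; apply: eq_avg => psi.
  by congr (g _ * h _); apply/ffunP => x; rewrite !ffunE.
rewrite -(avg_pair _ _ _ (fun p q => g p * h q)) mulrC -avgZ.
by apply: eq_avg => p; rewrite avgZ mulrC.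
Qed.

Lemma avg_collision A V (i j : A) : i != j -> (0 < #|V|)%N ->
  avg {ffun A -> V} (fun chi => (chi i == chi j)%:R) = #|V|%:R^-1.
Proof.
move=> ij V0; pose e (b : bool) := if b then i else j.
have inj_e : injective e.
  by move=> [] [] //= ij'; rewrite ij' eqxx in ij.
rewrite (eq_avg _ _ (fun psi : {ffun A -> V} => (fun chi : {ffun bool -> V} =>
  (chi true == chi false)%:R) [ffun a => psi (e a)])); last first.
  by move=> psi; rewrite !ffunE.
rewrite (avg_comp _ _ _ e (fun chi => (chi true == chi false)%:R))// /avg.
have -> : \sum_(chi : {ffun bool -> V}) (chi true == chi false)%:R = #|V|%:R :> R.
  (* The indicator of a constant map, as a sum over its possible value. *)
  transitivity (\sum_(chi : {ffun bool -> V}) \sum_(v : V) (chi == [ffun=> v])%:R : R).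
    apply: eq_bigr => chi _; case: eqP => [tf|ntf].
      rewrite (bigD1 (chi true))//= big1 ?addr0 => [|v vN].
        by rewrite (_ : _ == _)//; apply/eqP/ffunP => -[]; rewrite ffunE.
      by case: eqP => // chiE; rewrite chiE ffunE eqxx in vN.
    by rewrite big1// => v _; case: eqP => // chiE; case: ntf; rewrite chiE !ffunE.
  rewrite exchange_big/= (eq_bigr (fun=> 1)); first by rewrite sumr_const.
  move=> v _; rewrite (bigD1 [ffun=> v])//= eqxx big1 ?addr0// => chi /negPf ->//.
rewrite card_ffun card_bool -mulnn natrM invfM mulrA divff ?mul1r//.
by rewrite pnatr_eq0 -lt0n.
Qed.

End Average.
Arguments avg {R T}.

Definition T3 : digraph := @Digraph 2 (fun i j => (val i < val j)%N).

(** * Homomorphism densities as probabilities, and random samples of a digraph *)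

Section Sampling.
Variable R : realType.
Implicit Types F G : digraph.

(** The map [psi] need not be injective: a vertex may be drawn several times, and the sample has
    order k + 1 whatever the order of [G]. *)
Definition sample G k (psi : {ffun 'I_k.+1 -> 'I_(dn G).+1}) : digraph :=
  @Digraph k (fun i j => dE G (psi i) (psi j)).

Definition badtriple G x y z := [&& dE G x y, dE G y z & ~~ dE G x z].

(** The densities count classical sets; this returns to the boolean predicate. *)
Lemma mem_setb T (b : pred T) x : (x \in [set y | b y]) = b x.
Proof. by apply/idP/idP => [/set_mem|bx]; [|exact: mem_set]. Qed.

Lemma tdensE F G : tdens F G = avg (fun phi => (is_hom F G phi)%:R) :> R.
Proof.
rewrite /tdens /avg; congr (_ / _).
rewrite -sum1_card natr_sum big_mkcond/=; apply: eq_bigr => phi _.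
by rewrite mem_setb; case: is_hom.
Qed.

Lemma tdens_ge0 F G : 0 <= tdens F G :> R.
Proof. by rewrite tdensE avg_ge0. Qed.

Lemma ffun_ord_gt0 m n : (0 < #|{ffun 'I_m -> 'I_n.+1}|)%N.
Proof. by rewrite card_ffun !card_ord expn_gt0. Qed.

Lemma tdens_le1 F G : tdens F G <= 1 :> R.
Proof.
rewrite tdensE -[leRHS](@avg_const R {ffun 'I_(dn F).+1 -> 'I_(dn G).+1})//;
  last exact: ffun_ord_gt0.
by apply: le_avg => phi; rewrite lern1 leq_b1.
Qed.

(** Lets digraphs of different orders be counted on one common space of maps. *)
Lemma avg_hom (B : finType) F G (e : 'I_(dn F).+1 -> B) : injective e ->
  avg (fun psi : {ffun B -> 'I_(dn G).+1} => (is_hom F G [ffun i => psi (e i)])%:R)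
  = tdens F G :> R.
Proof.
by move=> inj; rewrite (avg_comp _ _ _ _ e (fun phi => (is_hom F G phi)%:R))
  ?card_ord// tdensE.
Qed.

Lemma is_homC1 G (phi : {ffun 'I_1 -> 'I_(dn G).+1}) :
  is_hom C1 G phi = dE G (phi ord0) (phi ord0).
Proof.
apply/forallP/idP => [/(_ ord0)/forallP/(_ ord0)//|h i].
by apply/forallP => j; rewrite !ord1.
Qed.

Lemma ord2_ind (P : 'I_2 -> Prop) : P ord0 -> P ord_max -> forall i, P i.
Proof.
move=> P0 P1 [[|[|//]] lti]; [move: P0|move: P1];
  by congr P; apply: val_inj.
Qed.

Definition ord3_1 : 'I_3 := Ordinal (isT : (1 < 3)%N).

Lemma ord3_ind (P : 'I_3 -> Prop) :
  P ord0 -> P ord3_1 -> P ord_max -> forall i, P i.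
Proof.
move=> P0 P1 P2 [[|[|[|//]]] lti]; [move: P0|move: P1|move: P2];
  by congr P; apply: val_inj.
Qed.

Lemma is_homC2 G (phi : {ffun 'I_2 -> 'I_(dn G).+1}) :
  is_hom C2 G phi = dE G (phi ord0) (phi ord_max) && dE G (phi ord_max) (phi ord0).
Proof.
apply/forallP/andP => [h|[h1 h2]].
  split; first by have /forallP/(_ ord_max) := h ord0.
  by have /forallP/(_ ord0) := h ord_max.
by elim/ord2_ind; apply/forallP; elim/ord2_ind.
Qed.

Lemma is_homP2 G (phi : {ffun 'I_3 -> 'I_(dn G).+1}) :
  is_hom P2 G phi = dE G (phi ord0) (phi ord3_1) && dE G (phi ord3_1) (phi ord_max).
Proof.
apply/forallP/andP => [h|[h1 h2]].
  split; first by have /forallP/(_ ord3_1) := h ord0.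
  by have /forallP/(_ ord_max) := h ord3_1.
by elim/ord3_ind; apply/forallP; elim/ord3_ind.
Qed.

Lemma is_homT3 G (phi : {ffun 'I_3 -> 'I_(dn G).+1}) :
  is_hom T3 G phi = [&& dE G (phi ord0) (phi ord3_1), dE G (phi ord3_1) (phi ord_max)
                     & dE G (phi ord0) (phi ord_max)].
Proof.
apply/forallP/and3P => [h|[h1 h2 h3]].
  split; [by have /forallP/(_ ord3_1) := h ord0| |].
  - by have /forallP/(_ ord_max) := h ord3_1.
  - by have /forallP/(_ ord_max) := h ord0.
by elim/ord3_ind; apply/forallP; elim/ord3_ind.
Qed.

Section Marginals.
Variables (B : finType) (G : digraph).
Implicit Type psi : {ffun B -> 'I_(dn G).+1}.

Lemma avg_loop (i : B) :
  avg (fun psi => (dE G (psi i) (psi i))%:R) = tdens C1 G :> R.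
Proof.
rewrite -(avg_hom B C1 G (fun=> i)) => [|x y _]; last by rewrite !ord1.
by apply: eq_avg => psi; rewrite is_homC1 !ffunE.
Qed.

Lemma avg_cyc2 (i j : B) : i != j ->
  avg (fun psi => (dE G (psi i) (psi j) && dE G (psi j) (psi i))%:R) = tdens C2 G :> R.
Proof.
move=> ij; rewrite -(avg_hom B C2 G (fun x => if x == ord0 then i else j)).
  by apply: eq_avg => psi; rewrite is_homC2 !ffunE.
have ji : j != i by rewrite eq_sym.
by elim/ord2_ind; elim/ord2_ind => //= /eqP; rewrite ?(negPf ij) ?(negPf ji).
Qed.

Lemma avg_badtriple (i j l : B) : i != j -> j != l -> i != l ->
  avg (fun psi => (badtriple G (psi i) (psi j) (psi l))%:R)
  = tdens P2 G - tdens T3 G :> R.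
Proof.
move=> ij jl il.
pose e (x : 'I_3) := if x == ord0 then i else if x == ord3_1 then j else l.
have inj_e : injective e.
  have ji : j != i by rewrite eq_sym.
  have lj : l != j by rewrite eq_sym.
  have li : l != i by rewrite eq_sym.
  elim/ord3_ind; elim/ord3_ind => //= /eqP; rewrite /e/=
    ?(negPf ij) ?(negPf jl) ?(negPf il) ?(negPf ji) ?(negPf lj) ?(negPf li)//.
rewrite -(avg_hom B P2 G e)// -(avg_hom B T3 G e)// -avgB.
apply: eq_avg => psi; rewrite is_homP2 is_homT3 /badtriple !ffunE /e/=.
by case: dE; case: dE; case: dE; rewrite /= ?subrr ?subr0.
Qed.

Lemma tdensP2_sub_ge0 : 0 <= tdens P2 G - tdens T3 G :> R.
Proof.
rewrite !tdensE subr_ge0; apply: le_avg => phi.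
by rewrite is_homP2 is_homT3; case: dE; case: dE; case: dE; rewrite //= ler01.
Qed.

End Marginals.

(** The witnesses can be taken distinct, as the marginals above require: transitivity cannot fail
    with i = j or j = l, and a failure with i = l exhibits a 2-cycle. *)
Lemma is_posetPn G : ~ is_poset G ->
  [\/ exists i, dE G i i,
      exists i j, i != j /\ dE G i j && dE G j i |
      exists i j l, [/\ i != j, j != l, i != l & badtriple G i j l] ].
Proof.
move=> nG; apply: contrapT => n; apply: nG; split=> [i|i j l ij jl].
  by apply/negP => ii; apply: n; constructor 1; exists i.
apply: contrapT => /negP nil.
have [eij|nij] := eqVneq i j; first by rewrite eij jl in nil.
have [ejl|njl] := eqVneq j l; first by rewrite -ejl ij in nil.
have [eil|nil'] := eqVneq i l.
  by apply: n; constructor 2; exists i, j; split=> //; rewrite ij eil jl.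
by apply: n; constructor 3; exists i, j, l; split=> //; rewrite /badtriple ij jl nil.
Qed.

Lemma is_hom_sample F G k (psi : {ffun 'I_k.+1 -> 'I_(dn G).+1})
    (phi : {ffun 'I_(dn F).+1 -> 'I_k.+1}) :
  is_hom F (sample G k psi) phi = is_hom F G [ffun i => psi (phi i)].
Proof.
by rewrite /is_hom; apply: eq_forallb => i; apply: eq_forallb => j; rewrite !ffunE.
Qed.

(* Two maps into the sample whose joint map is injective contribute
   uncorrelated terms; the others are a proportion O(1/k). *)
Lemma sample_variance F G k :
  avg (fun psi => (tdens F (sample G k psi) - tdens F G) ^+ 2)
  <= ((dn F).+1 + (dn F).+1)%:R ^+ 2 / k.+1%:R :> R.
Proof.
set t := tdens F G; set m := (dn F).+1.
pose h (phi : {ffun 'I_m -> 'I_(dn G).+1}) : R := (is_hom F G phi)%:R - t.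
have avgh : avg h = 0.
  by rewrite /h avgB avg_const ?ffun_ord_gt0// -tdensE subrr.
have h1 phi : `|h phi| <= 1.
  have := tdens_ge0 F G; have := tdens_le1 F G; rewrite -/t /h ler_norml.
  by case: is_hom => /= ? ?; lra.
pose e (chi : {ffun 'I_m + 'I_m -> 'I_k.+1}) x :=
  match x with
  | inl a => [ffun a => chi (inl a)] a
  | inr b => [ffun b => chi (inr b)] b
  end : 'I_k.+1.
pose u (psi : {ffun 'I_k.+1 -> 'I_(dn G).+1}) (phi1 phi2 : {ffun 'I_m -> 'I_k.+1}) : R :=
  h [ffun i => psi (phi1 i)] * h [ffun i => psi (phi2 i)].
have -> : avg (fun psi => (tdens F (sample G k psi) - t) ^+ 2) =
    avg (fun chi : {ffun 'I_m + 'I_m -> 'I_k.+1} => avg (fun psi =>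
      u psi [ffun a => chi (inl a)] [ffun b => chi (inr b)])).
  rewrite -[RHS]exchange_avg; apply: eq_avg => psi.
  rewrite -(avg_pair _ _ _ _ (u psi)).
  have -> : tdens F (sample G k psi) - t =
      avg (fun phi : {ffun 'I_m -> 'I_k.+1} => h [ffun i => psi (phi i)]).
    rewrite tdensE /h avgB avg_const ?ffun_ord_gt0//; congr (_ - _).
    by apply: eq_avg => phi; rewrite is_hom_sample.
  by rewrite expr2 -avgZ; apply: eq_avg => phi; rewrite mulrC avgZ.
(* A noninjective [chi] has a colliding pair and its term is at most 1, so the number of colliding
   pairs bounds the term in all cases. *)
apply: (@le_trans _ _ (avg (fun chi : {ffun 'I_m + 'I_m -> 'I_k.+1} =>
    \sum_(p : ('I_m + 'I_m) * ('I_m + 'I_m) | p.1 != p.2) (chi p.1 == chi p.2)%:R))).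
  apply: le_avg => chi; have [inj|/injectiveP ninj] := boolP (injectiveb chi).
    rewrite /u (@avg_indep _ _ _ _ _ [ffun a => chi (inl a)] [ffun b => chi (inr b)] h h)
      ?card_ord//; first by rewrite avgh mul0r sumr_ge0.
    move=> x y; have inj' := injectiveP _ inj.
    by case: x => x; case: y => y; rewrite !ffunE => /inj'.
  apply: (@le_trans _ _ 1).
    rewrite -[leRHS](@avg_const _ {ffun 'I_k.+1 -> 'I_(dn G).+1}) ?ffun_ord_gt0//.
    apply: le_avg => psi; rewrite /u (le_trans (ler_norm _))// normrM.
    by rewrite mulr_ile1.
  have [p p12 chip] : exists2 p : ('I_m + 'I_m) * ('I_m + 'I_m), p.1 != p.2 & chi p.1 == chi p.2.
    apply: contrapT => np; apply: ninj => x y xy; apply/eqP; apply: contrapT => /negP nxy.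
    by apply: np; exists (x, y) => //=; rewrite xy.
  by rewrite (bigD1 p)//= chip lerDl sumr_ge0.
rewrite avg_sum (eq_bigr (fun=> k.+1%:R^-1)) => [|p p12]; last first.
  by rewrite avg_collision ?card_ord.
rewrite sumr_const -[leLHS]mulr_natl ler_wpM2r ?invr_ge0// -natrX ler_nat.
apply: (leq_trans (max_card _)).
by rewrite card_prod card_sum !card_ord mulnn.
Qed.

(** Union bound over the possible violations: the coefficients bound the numbers of index tuples,
    the densities are the marginals computed above. *)
Lemma sample_not_poset G k :
  avg (fun psi => (~~ `[< is_poset (sample G k psi) >])%:R)
  <= k.+1%:R * tdens C1 G + k.+1%:R ^+ 2 * tdens C2 G
     + k.+1%:R ^+ 3 * (tdens P2 G - tdens T3 G) :> R.
Proof.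
apply: (@le_trans _ _ (avg (fun psi : {ffun 'I_k.+1 -> 'I_(dn G).+1} =>
    \sum_i (dE G (psi i) (psi i))%:R
    + \sum_(p : 'I_k.+1 * 'I_k.+1 | p.1 != p.2)
         (dE G (psi p.1) (psi p.2) && dE G (psi p.2) (psi p.1))%:R
    + \sum_(p : 'I_k.+1 * 'I_k.+1 * 'I_k.+1 |
            [&& p.1.1 != p.1.2, p.1.2 != p.2 & p.1.1 != p.2])
         (badtriple G (psi p.1.1) (psi p.1.2) (psi p.2))%:R))).
  apply: le_avg => psi.
  set s1 := \sum_i _; set s2 := \sum_(p | p.1 != p.2) _; set s3 := \sum_(p | _) _.
  have s1ge0 : 0 <= s1 by rewrite sumr_ge0.
  have s2ge0 : 0 <= s2 by rewrite sumr_ge0.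
  have s3ge0 : 0 <= s3 by rewrite sumr_ge0.
  case: asboolP => [_|/is_posetPn]/=; first by lra.
  case=> [[i ii]|[i [j [ij ijE]]]|[i [j [l [ij jl il bad]]]]].
  - suff : 1 <= s1 by lra.
    by rewrite /s1 (bigD1 i)//= [dE _ _ _]ii lerDl sumr_ge0.
  - suff : 1 <= s2 by lra.
    by rewrite /s2 (bigD1 (i, j))//= [_ && _]ijE lerDl sumr_ge0.
  - suff : 1 <= s3 by lra.
    rewrite /s3 (bigD1 (i, j, l))/=; last by rewrite ij jl il.
    by rewrite [badtriple _ _ _ _]bad lerDl sumr_ge0.
rewrite !avgD !avg_sum; apply: lerD; first apply: lerD.
- rewrite (eq_bigr (fun=> tdens C1 G)) => [|i _]; last exact: avg_loop.
  by rewrite sumr_const card_ord mulr_natl.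
- rewrite (eq_bigr (fun=> tdens C2 G)) => [|p p12]; last exact: avg_cyc2.
  rewrite sumr_const -[leLHS]mulr_natl ler_wpM2r ?tdens_ge0// -natrX ler_nat.
  by rewrite (leq_trans (max_card _))// card_prod !card_ord mulnn.
- rewrite (eq_bigr (fun=> tdens P2 G - tdens T3 G)) => [|p /and3P[? ? ?]]; last exact: avg_badtriple.
  rewrite sumr_const -[leLHS]mulr_natl ler_wpM2r ?tdensP2_sub_ge0// -natrX ler_nat.
  by rewrite (leq_trans (max_card _))// !card_prod !card_ord !expnS expn0 muln1 mulnA.
Qed.

(** First moment method. The functional [f] reaches 1 as soon as the sample fails to be a poset or
    one density deviates by [e] (Chebyshev), so an average below 1 leaves a sample with none of
    these defects. *)
Lemma sample_poset G k (I : finType) (Fs : I -> digraph) (e : R) : 0 < e ->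
  k.+1%:R * tdens C1 G + k.+1%:R ^+ 2 * tdens C2 G
  + k.+1%:R ^+ 3 * (tdens P2 G - tdens T3 G)
  + \sum_i e ^- 2 * (((dn (Fs i)).+1 + (dn (Fs i)).+1)%:R ^+ 2 / k.+1%:R) < 1 ->
  exists H, [/\ is_poset H, dn H = k &
    forall i, `|tdens (Fs i) H - tdens (Fs i) G| < e].
Proof.
move=> e0 bound.
pose f (psi : {ffun 'I_k.+1 -> 'I_(dn G).+1}) : R :=
  (~~ `[< is_poset (sample G k psi) >])%:R
  + \sum_i e ^- 2 * (tdens (Fs i) (sample G k psi) - tdens (Fs i) G) ^+ 2.
have e20 : 0 <= e ^- 2 by rewrite invr_ge0 exprn_ge0// ltW.
have [] := @avg_lt_ex _ _ f 1 _ (ffun_ord_gt0 _ _).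
  apply: le_lt_trans bound; rewrite /f avgD lerD ?sample_not_poset//.
  rewrite avg_sum ler_sum// => i _; rewrite avgZ.
  by rewrite ler_wpM2l// sample_variance.
move=> psi fpsi; exists (sample G k psi); split => //.
  apply: contrapT => np; move: fpsi; apply/negP; rewrite -leNgt /f asboolF//=.
  by rewrite lerDl sumr_ge0// => i _; rewrite mulr_ge0// sqr_ge0.
move=> i; apply: contrapT => /negP; rewrite -leNgt => le_e.
move: fpsi; apply/negP; rewrite -leNgt /f (bigD1 i)//=.
rewrite addrCA -[leLHS]addr0 lerD//; last first.
  by rewrite addr_ge0// sumr_ge0// => j _; rewrite mulr_ge0// sqr_ge0.
rewrite mulrC ler_pdivlMr ?exprn_gt0// mul1r -[leRHS]real_normK ?num_real//.
by rewrite lerXn2r ?nnegrE// ltW.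
Qed.

(** * Comparison of induced and homomorphism densities *)

Section InducedDensity.
Variables F G : digraph.

(** Normalized by all maps instead of the injective ones, in order to live on the same probability
    space as [tdens]. *)
Definition indavg : R := avg (fun phi => (is_ind_emb F G phi)%:R).

Let card_set (T : finType) (b : pred T) : #|[set x | b x]| = #|b|.
Proof. by apply: eq_card => x; rewrite mem_setb. Qed.

Let indavgE : indavg = #|[set phi | is_ind_emb F G phi]|%:R /
  ((nverts G) ^ (nverts F))%:R.
Proof.
rewrite /indavg /avg card_ffun !card_ord; congr (_ / _).
rewrite card_set -sum1_card natr_sum [RHS]big_mkcond/=; apply: eq_bigr => phi _.
by rewrite unfold_in -[_ && _]/(is_ind_emb F G phi); case: is_ind_emb.
Qed.

Let tindE : (nverts F <= nverts G)%N -> tind F G =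
  #|[set phi | is_ind_emb F G phi]|%:R / ((nverts G) ^_ (nverts F))%:R :> R.
Proof.
move=> le; rewrite /tind le; congr (_ / _%:R).
rewrite card_set -[X in _ = (X ^_ _)%N](card_ord (nverts G)) -[X in _ = (_ ^_ X)%N](card_ord (nverts F)).
rewrite -card_inj_ffuns; apply: eq_card => phi; rewrite finset.inE//.
Qed.

Lemma indavg_ge0 : 0 <= indavg. Proof. exact: avg_ge0. Qed.

Lemma indavg_le_tind : indavg <= tind F G.
Proof.
have [le|lt] := leqP (nverts F) (nverts G).
  rewrite tindE// indavgE ler_wpM2l// lef_pV2 ?posrE ?ltr0n ?expn_gt0 ?ffact_gt0//.
  rewrite ler_nat ffact_prod -[X in (_ <= _ ^ X)%N](card_ord (nverts F)) -prod_nat_const.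
  by apply: leq_prod => i _; exact: leq_subr.
rewrite /tind leqNgt lt/= /indavg /avg big1 ?mul0r// => phi _.
case: (boolP (is_ind_emb F G phi)) => // /andP[/injectiveP/leq_card].
by rewrite !card_ord leqNgt lt.
Qed.

(** For orders m <= n of [F] and [G], one has n <= m (n - i) for each i < m; the product over i
    compares the power n ^ m with the falling factorial. *)
Lemma tind_le_indavg : tind F G <= (nverts F ^ nverts F)%:R * indavg.
Proof.
have [le|lt] := leqP (nverts F) (nverts G); last first.
  by rewrite /tind leqNgt lt/= mulr_ge0// indavg_ge0.
rewrite tindE// indavgE mulrCA ler_wpM2l//.
rewrite ler_pdivlMr ?ltr0n ?expn_gt0// mulrC ler_pdivrMr ?ltr0n ?ffact_gt0//.
rewrite -natrM ler_nat ffact_prod.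
have cst c : (c ^ nverts F = \prod_(i < nverts F) c)%N by rewrite prod_nat_const card_ord.
rewrite [X in (X <= _)%N]cst [X in (_ <= X * _)%N]cst -big_split/=.
apply: leq_prod => i _; have := ltn_ord i; nia.
Qed.

End InducedDensity.

Lemma ler_bool (a b : bool) : (a -> b) -> a%:R <= b%:R :> R.
Proof. by move=> ab; rewrite ler_nat; case: a ab => // ->. Qed.

(** A defect of [F] at given vertices reappears at their images in every induced copy, so one of the
    three terms bounds the induced density. *)
Lemma tind_not_poset F G : ~ is_poset F ->
  tind F G <= (nverts F ^ nverts F)%:R *
    (tdens C1 G + tdens C2 G + (tdens P2 G - tdens T3 G)) :> R.
Proof.
move=> nF; apply: (le_trans (tind_le_indavg F G)); rewrite ler_wpM2l//.
have := tdens_ge0 C1 G; have := tdens_ge0 C2 G; have := tdensP2_sub_ge0 G.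
have := is_posetPn _ nF.
case=> [[i ii]|[i [j [ij ijE]]]|[i [j [l [ij jl il bad]]]]].
- suff : indavg F G <= tdens C1 G by lra.
  rewrite -(avg_loop _ G i); apply: le_avg => phi; apply: ler_bool.
  by move=> /andP[_ /forallP/(_ i)/forallP/(_ i)/eqP <-].
- suff : indavg F G <= tdens C2 G by lra.
  rewrite -(avg_cyc2 _ G i j)//; apply: le_avg => phi; apply: ler_bool.
  move=> /andP[_ /forallP h].
  by have /forallP/(_ j)/eqP <- := h i; have /forallP/(_ i)/eqP <- := h j.
- suff : indavg F G <= tdens P2 G - tdens T3 G by lra.
  rewrite -(avg_badtriple _ G i j l)//; apply: le_avg => phi; apply: ler_bool.
  move=> /andP[_ /forallP h]; rewrite /badtriple.
  have /forallP/(_ j)/eqP <- := h i; have /forallP/(_ l)/eqP <- := h j.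
  by have /forallP/(_ l)/eqP <- := h i.
Qed.

Lemma tdensC1_le G : tdens C1 G <= tind C1 G :> R.
Proof.
apply: le_trans (indavg_le_tind _ _).
rewrite tdensE; apply: le_avg => phi; apply: ler_bool.
rewrite is_homC1 => h; apply/andP; split.
  by apply/injectiveP => x y _; rewrite !ord1.
by apply/forallP => x; apply/forallP => y; rewrite !ord1 h.
Qed.

(** A homomorphic 2-cycle whose vertices carry no loop has two distinct vertices and is induced. *)
Lemma tdensC2_le G : tdens C2 G <= tind C2 G + 2 * tdens C1 G :> R.
Proof.
apply: (@le_trans _ _ (indavg C2 G + 2 * tdens C1 G)); last first.
  by rewrite lerD2r indavg_le_tind.
rewrite mulr_natl mulr2n -{1}(avg_loop 'I_2 G ord0) -(avg_loop 'I_2 G ord_max).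
rewrite tdensE -!avgD; apply: le_avg => phi.
rewrite -!natrD ler_nat is_homC2.
have [l0|n0] := boolP (dE G (phi ord0) (phi ord0)); first by case: (_ && _); lia.
have [l1|n1] := boolP (dE G (phi ord_max) (phi ord_max)); first by case: (_ && _); lia.
have [/andP[e1 e2]|//] := boolP (_ && _).
suff -> : is_ind_emb C2 G phi by [].
apply/andP; split.
  apply/injectiveP; elim/ord2_ind; elim/ord2_ind => // h.
    by move: n1; rewrite -{1}h e1.
  by move: n0; rewrite -{2}h e1.
by apply/forallP; elim/ord2_ind; apply/forallP; elim/ord2_ind => /=;
  rewrite ?(negPf n0) ?(negPf n1) ?e1 ?e2.
Qed.

(** A bad triple whose vertices carry no loop and no 2-cycle is injective; it induces [C3] or [P2]
    according to whether the last vertex points to the first. The coefficients 3 count the loops and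
    2-cycles excluded. *)
Lemma tdensP2_sub_le G : tdens P2 G - tdens T3 G <=
  tind P2 G + tind C3 G + 3 * tdens C1 G + 3 * tdens C2 G :> R.
Proof.
apply: (@le_trans _ _ (indavg P2 G + indavg C3 G + 3 * tdens C1 G + 3 * tdens C2 G)); last first.
  by rewrite !lerD2r lerD// indavg_le_tind.
pose o0 : 'I_3 := ord0; pose o1 := ord3_1; pose o2 : 'I_3 := ord_max.
have -> : 3 * tdens C1 G = avg (fun phi : {ffun 'I_3 -> 'I_(dn G).+1} => (dE G (phi o0) (phi o0))%:R)
    + avg (fun phi : {ffun 'I_3 -> 'I_(dn G).+1} => (dE G (phi o1) (phi o1))%:R)
    + avg (fun phi : {ffun 'I_3 -> 'I_(dn G).+1} => (dE G (phi o2) (phi o2))%:R) :> R.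
  by rewrite !avg_loop; ring.
have -> : 3 * tdens C2 G =
    avg (fun phi : {ffun 'I_3 -> 'I_(dn G).+1} => (dE G (phi o0) (phi o1) && dE G (phi o1) (phi o0))%:R)
    + avg (fun phi : {ffun 'I_3 -> 'I_(dn G).+1} => (dE G (phi o1) (phi o2) && dE G (phi o2) (phi o1))%:R)
    + avg (fun phi : {ffun 'I_3 -> 'I_(dn G).+1} => (dE G (phi o0) (phi o2) && dE G (phi o2) (phi o0))%:R) :> R.
  by rewrite !avg_cyc2//; ring.
rewrite -(avg_badtriple _ G o0 o1 o2)// -!avgD; apply: le_avg => phi.
rewrite -!natrD ler_nat.
have [/and3P[e01 e12 n02]|//] := boolP (badtriple _ _ _ _).
have [|l0] := boolP (dE G (phi o0) (phi o0)); first by rewrite /= !(addn1, addSn, addnS).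
have [|l1] := boolP (dE G (phi o1) (phi o1)); first by rewrite /= !(addn1, addSn, addnS).
have [|l2] := boolP (dE G (phi o2) (phi o2)); first by rewrite /= !(addn1, addSn, addnS).
rewrite e01 e12 (negPf n02)/=.
have [|n10] := boolP (dE G (phi o1) (phi o0)); first by rewrite /= !(addn1, addSn, addnS).
have [|n21] := boolP (dE G (phi o2) (phi o1)); first by rewrite /= !(addn1, addSn, addnS).
have inj : injectiveb phi.
  have f01 : phi o0 <> phi o1 by move=> h; move: l1; rewrite -{1}h e01.
  have f02 : phi o0 <> phi o2 by move=> h; move: n10; rewrite h e12.
  have f12 : phi o1 <> phi o2 by move=> h; move: l2; rewrite -{1}h e12.
  apply/injectiveP; elim/ord3_ind; elim/ord3_ind => // h; exfalso;
    by [exact: f01|exact: f02|exact: f12|apply: f01|apply: f02|apply: f12].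
have [e20|n20] := boolP (dE G (phi o2) (phi o0)).
  suff -> : is_ind_emb C3 G phi by rewrite /= !(addn1, addSn, addnS, add1n).
  apply/andP; split => //; apply/forallP; elim/ord3_ind; apply/forallP; elim/ord3_ind => /=;
    by rewrite ?e01 ?e12 ?e20 ?(negPf l0) ?(negPf l1) ?(negPf l2) ?(negPf n02) ?(negPf n10) ?(negPf n21).
suff -> : is_ind_emb P2 G phi by rewrite /= !(addn1, addSn, addnS, add1n).
apply/andP; split => //; apply/forallP; elim/ord3_ind; apply/forallP; elim/ord3_ind => /=;
  by rewrite ?e01 ?e12 ?(negPf n20) ?(negPf l0) ?(negPf l1) ?(negPf l2) ?(negPf n02) ?(negPf n10) ?(negPf n21).
Qed.

End Sampling.

(** * Closure of the set of posets *)

Section Limits.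
Variable R : realType.
Implicit Types (Gam : DPt R) (F G : digraph).

Lemma ptws_cvgP (F : set_system (DPt R)) Gam : Filter F ->
  F --> Gam <-> forall o, (fun g : DPt R => g o) @ F --> Gam o.
Proof.
move=> FF; rewrite cvg_sup; split=> h o; have := h o.
  rewrite cvg_image; last by rewrite eqEsubset; split=> v // _; exists (cst v).
  apply: cvg_trans => W /=; rewrite ?nbhs_simpl /fmap /= => [[W' + <-]].
  by apply: filterS => g W'g /=; exists g.
rewrite cvg_image; last by rewrite eqEsubset; split=> v // _; exists (cst v).
move=> + W //=; rewrite ?nbhs_simpl => Q => /Q Q'; exists (@^~ o @^-1` W) => //.
by rewrite eqEsubset; split => [j [? + <-//]|j Wj]; exists (fun _ => j).
Qed.

Lemma eval_cvg Gam o : (fun g : DPt R => g o) @ nbhs Gam --> Gam o.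
Proof. by move: o; apply/ptws_cvgP; exact: cvg_id. Qed.

(** The sets described form a filter that converges to [Gam] in every coordinate, hence contains all
    neighbourhoods of [Gam]. *)
Lemma nbhs_ptws Gam (U : set (DPt R)) : nbhs Gam U ->
  exists (I : finType) (o : I -> option digraph) (e : R), 0 < e /\
    forall g : DPt R, (forall i, `|g (o i) - Gam (o i)| < e) -> U g.
Proof.
pose B : set_system (DPt R) := [set U |
  exists (I : finType) (o : I -> option digraph) (e : R), 0 < e /\
    forall g : DPt R, (forall i, `|g (o i) - Gam (o i)| < e) -> U g].
have BF : Filter B.
  split.
  - by exists void, (fun=> None), 1.
  - move=> P Q [J [q [e [e0 h]]]] [J' [q' [e' [e'0 h']]]].
    exists (J + J')%type, (fun x => match x with inl i => q i | inr i => q' i end).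
    exists (Num.min e e'); split; first by rewrite lt_min e0.
    move=> g hg; split; [apply: h => i; have := hg (inl i)|apply: h' => i; have := hg (inr i)];
      by rewrite lt_min => /andP[].
  - move=> P Q PQ [J [q [e [e0 h]]]]; exists J, q, e; split => // g hg.
    by apply: PQ; exact: h.
suff : B --> Gam by apply.
apply/ptws_cvgP => o; apply/cvgrPdist_lt => e e0.
by exists unit, (fun=> o), e; split => // g /(_ tt); rewrite distrC.
Qed.

#[local] Instance DF_filter Gam : Filter (DF Gam).
Proof.
split.
- by exists setT => //; exact: filterT.
- move=> P Q [U nU UP] [V nV VQ]; exists (U `&` V); first exact: filterI.
  by move=> G [UG VG]; split; [exact: UP|exact: VQ].
- by move=> P Q PQ [U nU UP]; exists U => // G /UP/PQ.
Qed.

Lemma DF_proper Gam : closure Dset Gam -> ProperFilter (DF Gam).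
Proof.
move=> cl; split; last exact: DF_filter.
by move=> [U nU UP]; have [_ [[G _ <-] /UP]] := cl U nU.
Qed.

Lemma cvg_tdens Gam F : tdens F @ DF Gam --> Gam (Some F).
Proof.
move=> V nV; exists ((fun g : DPt R => g (Some F)) @^-1` V) => //.
exact: eval_cvg nV.
Qed.

Definition transitive_limit Gam :=
  [/\ Gam (Some C1) = 0, Gam (Some C2) = 0 & Gam (Some P2) = Gam (Some T3)].

Lemma closed_eval_eq (f : DPt R -> R) c : continuous f -> closed [set g | f g = c].
Proof.
move=> cf; have := @closed_comp _ _ f [set c]; apply => //; exact: closed_eq.
Qed.

Lemma tdens_poset G : is_poset G ->
  [/\ tdens C1 G = 0 :> R, tdens C2 G = 0 :> R & tdens P2 G = tdens T3 G :> R].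
Proof.
move=> [irr tr]; split; rewrite !tdensE.
- rewrite /avg big1 ?mul0r// => phi _; rewrite is_homC1 (negPf (irr _))//.
- rewrite /avg big1 ?mul0r// => phi _; rewrite is_homC2.
  by case: (boolP (_ && _)) => // /andP[/tr h /h]; rewrite (negPf (irr _)).
- apply: eq_avg => phi; rewrite is_homP2 is_homT3.
  case: (boolP (dE _ _ _)) => //= h1; case: (boolP (dE _ _ _)) => //= h2.
  by rewrite (tr _ _ _ h1 h2).
Qed.

(** The three identities hold at posets and are closed conditions on the coordinates. *)
Lemma Pset_closure_transitive Gam : closure Pset Gam -> transitive_limit Gam.
Proof.
have ev o : continuous (fun g : DPt R => g o) by move=> g; exact: eval_cvg.
have cl (f : DPt R -> R) : continuous f -> (forall G, is_poset G -> f (emb G) = 0) ->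
    closure Pset `<=` [set g | f g = 0].
  move=> cf f0; have /closure_id -> := closed_eval_eq f 0 cf.
  by apply: closureS => _ [G PG <-]; exact: f0.
move=> Gcl; split.
- by apply: (cl (fun g => g (Some C1)) _ _ _ Gcl) => // G /tdens_poset[].
- by apply: (cl (fun g => g (Some C2)) _ _ _ Gcl) => // G /tdens_poset[].
- apply/eqP; rewrite -subr_eq0; apply/eqP.
  apply: (cl (fun g => g (Some P2) - g (Some T3)) _ _ _ Gcl).
    by move=> g; exact: (cvgB (eval_cvg g (Some P2)) (eval_cvg g (Some T3))).
  by move=> G /tdens_poset[_ _ /= ->]; rewrite subrr.
Qed.

Lemma transitive_tind_lim Gam F : transitive_limit Gam -> ~ is_poset F ->
  tind_lim_is F Gam 0.
Proof.
move=> [h1 h2 h3] nF; rewrite /tind_lim_is.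
pose c : R := (nverts F ^ nverts F)%:R.
have bnd : \forall G \near DF Gam, (cst 0 G : R) <= tind F G <=
    c * (tdens C1 G + tdens C2 G + (tdens P2 G - tdens T3 G)).
  apply: filterE => G; rewrite tind_not_poset// andbT /cst /tind.
  by case: ifP => // _; rewrite divr_ge0.
have lim0 : (fun G => c * (tdens C1 G + tdens C2 G + (tdens P2 G - tdens T3 G)))
    @ DF Gam --> (0 : R).
  have -> : 0 = c * (Gam (Some C1) + Gam (Some C2) + (Gam (Some P2) - Gam (Some T3))).
    by rewrite h1 h2 h3 subrr !addr0 mulr0.
  apply: cvgM; first exact: cvg_cst.
  exact: (cvgD (cvgD (cvg_tdens Gam C1) (cvg_tdens Gam C2))
               (cvgB (cvg_tdens Gam P2) (cvg_tdens Gam T3))).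
exact: (squeeze_cvgr bnd (cvg_cst _) lim0).
Qed.

Lemma not_poset_C1 : ~ is_poset C1.
Proof. by case=> /(_ ord0). Qed.

Lemma not_poset_C2 : ~ is_poset C2.
Proof. by case=> _ /(_ ord0 ord_max ord0 isT isT). Qed.

Lemma not_poset_C3 : ~ is_poset C3.
Proof. by case=> _ /(_ ord0 ord3_1 ord_max isT isT). Qed.

Lemma not_poset_P2 : ~ is_poset P2.
Proof. by case=> _ /(_ ord0 ord3_1 ord_max isT isT). Qed.

Lemma DF_le Gam (f g : digraph -> R) (a b : R) : ProperFilter (DF Gam) ->
  f @ DF Gam --> a -> g @ DF Gam --> b -> (forall G, f G <= g G) -> a <= b.
Proof.
move=> PF fa gb fg; rewrite leNgt; apply/negP => ba.
have d0 : 0 < (a - b) / 2 by rewrite divr_gt0// subr_gt0.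
have /cvgr_dist_lt/(_ _ d0) na := fa; have /cvgr_dist_lt/(_ _ d0) nb := gb.
have [G []] := filter_ex (filterI na nb).
by rewrite !ltr_norml => /andP[? ?] /andP[? ?]; have := fg G; lra.
Qed.

(** The order [C1], [C2], [P2] is forced: each bound contains the densities treated before it. *)
Lemma tind_lim_transitive Gam : closure Dset Gam ->
  tind_lim_is C1 Gam 0 -> tind_lim_is C2 Gam 0 ->
  tind_lim_is C3 Gam 0 -> tind_lim_is P2 Gam 0 -> transitive_limit Gam.
Proof.
move=> /DF_proper PF c1 c2 c3 p2.
have c0 : (cst 0 : digraph -> R) @ DF Gam --> (0 : R) by exact: cvg_cst.
have t0 F : 0 <= Gam (Some F).
  apply: (DF_le _ _ _ _ _ PF c0 (cvg_tdens Gam F)).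
  by move=> G; exact: tdens_ge0.
have h1 : Gam (Some C1) = 0.
  apply/eqP; rewrite eq_le t0 andbT; apply: (DF_le _ _ _ _ _ PF (cvg_tdens Gam C1) c1).
  by move=> G; exact: tdensC1_le.
have h2 : Gam (Some C2) = 0.
  apply/eqP; rewrite eq_le t0 andbT.
  have : (fun G => tind C2 G + 2 * tdens C1 G) @ DF Gam --> 0 + 2 * (0 : R).
    by apply: cvgD => //; apply: cvgM; [exact: cvg_cst|rewrite -h1; exact: cvg_tdens].
  rewrite mulr0 addr0 => c; apply: (DF_le _ _ _ _ _ PF (cvg_tdens Gam C2) c).
  by move=> G; exact: tdensC2_le.
split=> //; apply/eqP; rewrite eq_le -[X in _ && X]subr_ge0 -subr_le0; apply/andP; split.
  have : (fun G => tind P2 G + tind C3 G + 3 * tdens C1 G + 3 * tdens C2 G) @ DF Gam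
      --> 0 + 0 + 3 * (0 : R) + 3 * 0.
    apply: cvgD; first apply: cvgD; first exact: cvgD.
      by apply: cvgM; [exact: cvg_cst|rewrite -h1; exact: cvg_tdens].
    by apply: cvgM; [exact: cvg_cst|rewrite -h2; exact: cvg_tdens].
  rewrite mulr0 !addr0 => c.
  apply: (DF_le _ _ _ _ _ PF (cvgB (cvg_tdens Gam P2) (cvg_tdens Gam T3)) c).
  by move=> G; exact: tdensP2_sub_le.
apply: (DF_le _ _ _ _ _ PF c0
  (cvgB (cvg_tdens Gam P2) (cvg_tdens Gam T3))).
by move=> G; exact: tdensP2_sub_ge0.
Qed.

Lemma emb_ge0 G o : 0 <= emb G o :> R.
Proof. by case: o => [F|] /=; rewrite ?tdens_ge0// invr_ge0. Qed.

(* There are finitely many digraphs of bounded order, so the point Gam, not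
   being a digraph, can be separated from all of them at once. *)
Lemma Dinf_order Gam : Dinf Gam -> Gam None = 0.
Proof.
move=> [cl nD]; apply/eqP; apply: contrapT => /negP Gam0.
have GamN : 0 < Gam None.
  rewrite lt_neqAle eq_sym Gam0/= leNgt; apply/negP => lt0.
  have /cvgr_dist_lt/(_ (- Gam None)) : (fun g : DPt R => g None) @ nbhs Gam --> Gam None.
    exact: eval_cvg.
  rewrite oppr_gt0 => /(_ lt0) nG; have [_ [[G _ <-]]] := cl _ nG.
  rewrite /= ltr_norml => /andP[+ _].
  have := emb_ge0 G None; rewrite /= => h; lra.
(* A digraph whose inverse order exceeds half of [Gam None] has fewer than [N] vertices. *)
have [N NG] : exists N : nat, (Gam None / 2)^-1 < N%:R.
  by exists (Num.bound (Gam None / 2)^-1); rewrite archi_boundP// invr_ge0 ltW// divr_gt0.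
(* Codes for all digraphs with at most [N] vertices, so that a finite type indexes the separating
   neighbourhoods. *)
pose T := {n : 'I_N & {ffun 'I_n.+1 * 'I_n.+1 -> bool}}.
pose dg (x : T) : digraph := @Digraph (tag x) (fun i j => tagged x (i, j)).
have sep (x : T) : \forall g \near Gam, g != emb (dg x) :> DPt R.
  have [q Gq] : exists q, Gam q != emb (dg x) q.
    apply: contrapT => /forallNP h; apply: nD; exists (dg x) => //.
    by apply/funext => q; apply/esym/eqP/negPn/negP; exact: h.
  have dpos : 0 < `|Gam q - emb (dg x) q| by rewrite normr_gt0 subr_eq0.
  have /cvgr_dist_lt/(_ _ dpos) := eval_cvg Gam q.
  by apply: filterS => g; apply: contraTneq => ->; rewrite ltxx.
have sepT := filter_forall (nbhs_filter Gam) sep.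
have half : 0 < Gam None / 2 by rewrite divr_gt0.
have /cvgr_dist_lt/(_ _ half) near_order := eval_cvg Gam None.
have [_ [[G _ <-] [h1 h2]]] := cl _ (filterI sepT near_order).
have lt : (dn G < N)%N.
  move: h2; rewrite /= ltr_norml => /andP[_ h2].
  have : Gam None / 2 < (nverts G)%:R^-1 by lra.
  rewrite -[X in X < _]invrK ltf_pV2 ?posrE ?invr_gt0// => h3.
  by have := lt_trans h3 NG; rewrite ltr_nat => /ltnW.
have := h1 (Tagged (fun n : 'I_N => {ffun 'I_n.+1 * 'I_n.+1 -> bool})
              ([ffun p => dE G p.1 p.2] : {ffun 'I_(Ordinal lt).+1 * 'I_(Ordinal lt).+1 -> bool})).
apply/negP; rewrite negbK; apply/eqP; congr emb.
rewrite /dg/=; case: G {h1 h2} lt => n E lt /=; congr Digraph.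
by apply/funext => i; apply/funext => j; rewrite ffunE.
Qed.

Lemma transitive_Pinf Gam : Dinf Gam -> transitive_limit Gam -> Pinf Gam.
Proof.
move=> DGam [h1 h2 h3]; have G0 := Dinf_order _ DGam.
have [cl nD] := DGam; split; last first.
  by move=> [G _ GE]; apply: nD; exists G.
move=> U /nbhs_ptws[J [q [e [e0 hU]]]].
(* For the order coordinate [None] the value [C1] is a dummy; that coordinate is controlled by the
   choice of [k]. *)
pose Fs i := if q i is Some F then F else C1.
pose S : R := \sum_i (e / 2) ^- 2 * (((dn (Fs i)).+1 + (dn (Fs i)).+1)%:R ^+ 2).
have e2 : 0 < e / 2 by rewrite divr_gt0.
have S0 : 0 <= S.
  by rewrite sumr_ge0// => i _; rewrite mulr_ge0 ?exprn_ge0// invr_ge0 exprn_ge0// ltW.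
(* Half of the budget 1 of [sample_poset] goes to the variance term; the other condition puts the
   inverse order of the sample below [e]. *)
have [k kS ke] : exists2 k : nat, S / k.+1%:R < 1 / 2 & k.+1%:R^-1 < e.
  have b0 : 0 <= 2 * S + e^-1 by rewrite addr_ge0 ?mulr_ge0// invr_ge0 ltW.
  exists (Num.bound (2 * S + e^-1)); set k := Num.bound _.
    rewrite ltr_pdivrMr// mul1r ltr_pdivlMl//.
    have := archi_boundP b0; rewrite -/k.
    by have : 0 < e^-1 by [rewrite invr_gt0]; rewrite -natr1; lra.
  rewrite invf_plt ?posrE//.
  have := archi_boundP b0; rewrite -/k.
  rewrite -natr1; lra.
pose K : R := k.+1%:R.
have K1 : 1 <= K by rewrite ler1n.
have K3 : 0 < (16 * K ^+ 3)^-1 by rewrite invr_gt0 mulr_gt0// exprn_gt0// (lt_le_trans _ K1).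
(* With [K] fixed, the bound 1 / (16 K ^ 3) leaves loops, 2-cycles and bad triples the shares 1/16,
   1/16 and 2/16, the last one doubled because it is a difference of two densities. *)
pose d := Num.min (e / 2) (16 * K ^+ 3)^-1.
have d0 : 0 < d by rewrite lt_min e2.
have nearF F : \forall g \near Gam, `|Gam (Some F) - g (Some F)| < d.
  by have /cvgr_dist_lt/(_ _ d0) := eval_cvg Gam (Some F).
pose Fs' (x : J + 'I_4) :=
  match x with inl i => Fs i | inr i => nth C1 [:: C1; C2; P2; T3] i end.
have nearJ := filter_forall (nbhs_filter Gam) (fun x => nearF (Fs' x)).
have [g [[G _ GE] hG]] := cl _ nearJ; rewrite -{}GE{g} in hG.
have hGJ i := hG (inl i); have hGI n (ltn4 : (n < 4)%N) := hG (inr (Ordinal ltn4)).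
move: (hGI 0%N isT) (hGI 1%N isT) (hGI 2%N isT) (hGI 3%N isT) hGJ => {hG hGI}.
rewrite /= h1 h2 => hG1 hG2 hG3 hG4 hGJ.
have [H [PH dnH hH]] : exists H, [/\ is_poset H, dn H = k &
    forall i, `|tdens (Fs i) H - tdens (Fs i) G| < e / 2].
  apply: sample_poset => //; rewrite -/K.
  have -> : \sum_i (e / 2) ^- 2 * (((dn (Fs i)).+1 + (dn (Fs i)).+1)%:R ^+ 2 / K) = S / K.
    by rewrite /S mulr_suml; apply: eq_bigr => i _; rewrite mulrA.
  have dK : d * (16 * K ^+ 3) <= 1.
    rewrite -ler_pdivlMr ?mul1r; first by rewrite ge_min lexx orbT.
    by rewrite -invr_gt0.
  have K2K3 : K ^+ 2 <= K ^+ 3 by rewrite ler_weXn2l.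
  have KK3 : K <= K ^+ 3 by rewrite -[leLHS]expr1 ler_weXn2l.
  have a1 : K * tdens C1 G <= K ^+ 3 * d.
    rewrite ler_pM ?tdens_ge0 ?(le_trans _ K1)//.
    by move: hG1; rewrite sub0r normrN => /ltW; apply: le_trans; exact: ler_norm.
  have a2 : K ^+ 2 * tdens C2 G <= K ^+ 3 * d.
    rewrite ler_pM ?tdens_ge0 ?exprn_ge0 ?(le_trans _ K1)//.
    by move: hG2; rewrite sub0r normrN => /ltW; apply: le_trans; exact: ler_norm.
  have a3 : K ^+ 3 * (tdens P2 G - tdens T3 G) <= K ^+ 3 * (2 * d).
    rewrite ler_wpM2l ?exprn_ge0 ?(le_trans _ K1)//.
    move: hG3 hG4; rewrite h3 !ltr_norml => /andP[? ?] /andP[? ?]; lra.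
  have dK' : K ^+ 3 * d <= 1 / 16 by lra.
  rewrite mulrCA in a3; move: kS; rewrite -/K.
  move: (S / K) (K * tdens C1 G) (K ^+ 2 * tdens C2 G) (K ^+ 3 * _) (K ^+ 3 * d) a1 a2 a3 dK'.
  move=> *; lra.
exists (emb H); split; first by exists H.
apply: hU => i; move: (hH i) (hGJ i); rewrite /Fs.
case: (q i) => [F|] /= hF hG; last first.
  by rewrite G0 subr0 ger0_norm ?invr_ge0// /nverts dnH.
have -> : tdens F H - Gam (Some F) = (tdens F H - tdens F G) - (Gam (Some F) - tdens F G) by ring.
rewrite (le_lt_trans (ler_normB _ _))//.
have : `|Gam (Some F) - tdens F G| < e / 2 by apply: (lt_le_trans hG); rewrite ge_min lexx.
lra.
Qed.

End Limits.

(** * Null sets and iterated integrals *)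

Section AlmostEverywhere.
Context {d : measure_display} {T : measurableType d} {R : realType}.
Variable mu : {measure set T -> \bar R}.
Local Open Scope ereal_scope.
Import HBNNSimple.

Lemma aeS (P Q : T -> Prop) : (forall x, P x -> Q x) ->
  {ae mu, forall x, P x} -> {ae mu, forall x, Q x}.
Proof. by move=> PQ; apply: negligibleS => x /= nQ /PQ. Qed.

Lemma aeI (P Q : T -> Prop) : {ae mu, forall x, P x} -> {ae mu, forall x, Q x} ->
  {ae mu, forall x, P x /\ Q x}.
Proof.
move=> aeP aeQ; apply: negligibleS (negligibleU aeP aeQ) => x /= nPQ.
by have [Px|] := pselect (P x); [right => Qx; exact: nPQ|left].
Qed.

(* No measurability is assumed: the integral of a nonnegative function is a
   supremum over simple functions, which can be cut off on a null set. *)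
Lemma ge0_ae_le_integral_gen (f g : T -> \bar R) :
  (forall x, 0 <= f x) -> (forall x, 0 <= g x) ->
  {ae mu, forall x, f x <= g x} -> \int[mu]_x f x <= \int[mu]_x g x.
Proof.
move=> f0 g0 [N [mN N0 fgN]]; rewrite !ge0_integralTE//.
apply: ge_ereal_sup => _ [h hf <-].
have mNC : measurable (~` N) by exact: measurableC.
pose h' := proj_nnsfun h mNC.
have -> : sintegral mu h = sintegral mu h'.
  rewrite -!integralT_nnsfun; apply: ae_eq_integral => //.
  - exact/measurable_EFinP.
  - exact/measurable_EFinP.
  - exists N; split => // x /=; apply: contra_notP => nNx _.
    by rewrite mindicE mem_set// mulr1.
apply: ereal_sup_ubound; exists h' => // x.
rewrite /h' /= mindicE; have [xN|xN] := boolP (x \in ~` N); last first.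
  by rewrite mulr0 g0.
rewrite mulr1 (le_trans (hf x))//; apply: contrapT => fg.
by move: (set_mem xN); apply; apply: fgN.
Qed.

Lemma ge0_ae_eq_integral_gen (D : set T) (f g : T -> \bar R) :
  (forall x, D x -> 0 <= f x) -> (forall x, D x -> 0 <= g x) ->
  {ae mu, forall x, D x -> f x = g x} ->
  \int[mu]_(x in D) f x = \int[mu]_(x in D) g x.
Proof.
move=> f0 g0 fg; rewrite integral_mkcond [RHS]integral_mkcond.
have fD0 x : 0 <= (f \_ D) x.
  by rewrite patchE; case: ifPn => // /set_mem; exact: f0.
have gD0 x : 0 <= (g \_ D) x.
  by rewrite patchE; case: ifPn => // /set_mem; exact: g0.
apply/eqP; rewrite eq_le; apply/andP; split;
  apply: ge0_ae_le_integral_gen => //; apply: aeS fg => x fgx;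
  by rewrite !patchE; case: ifPn => // /set_mem/fgx ->.
Qed.

Lemma ge0_integral_eq0P (f : T -> \bar R) : measurable_fun setT f ->
  (forall x, 0 <= f x) -> \int[mu]_x f x = 0 <-> {ae mu, forall x, f x = 0}.
Proof.
move=> mf f0.
have -> : \int[mu]_x f x = \int[mu]_x `|f x|.
  by apply: eq_integral => x _; rewrite gee0_abs.
rewrite ae_eq_integral_abs//; split; apply: aeS => x; first exact.
by move=> -> _.
Qed.

(** The nonnegative difference has integral 0; finiteness permits subtracting the common
    integral. *)
Lemma ae_eq_of_integral_eq (f g : T -> R) :
  measurable_fun setT f -> measurable_fun setT g ->
  (forall x, 0 <= f x <= g x)%R ->
  \int[mu]_x (f x)%:E = \int[mu]_x (g x)%:E -> \int[mu]_x (f x)%:E < +oo ->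
  {ae mu, forall x, f x = g x}.
Proof.
move=> mf mg fg eqI finI.
have f0 x : (0 <= f x)%R by have /andP[] := fg x.
have d0 x : (0 <= g x - f x)%R by have /andP[_ h] := fg x; rewrite subr_ge0.
have md : measurable_fun setT (fun x => (g x - f x)%:E).
  by apply/measurable_EFinP; exact: measurable_funB.
have mfE : measurable_fun setT (fun x => (f x)%:E) by exact/measurable_EFinP.
have d0E x : 0 <= (g x - f x)%:E by rewrite lee_fin.
have f0E x : 0 <= (f x)%:E by rewrite lee_fin.
have If : \int[mu]_x (f x)%:E \is a fin_num by rewrite ge0_fin_numE// integral_ge0.
have d_int0 : \int[mu]_x (g x - f x)%:E = 0.
  have : \int[mu]_x (g x)%:E = \int[mu]_x (f x)%:E + \int[mu]_x (g x - f x)%:E.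
    by rewrite -ge0_integralD//; apply: eq_integral => x _; rewrite -EFinD addrC subrK.
  rewrite -eqI => /(congr1 (fun z => z - \int[mu]_x (f x)%:E)).
  by rewrite subee// addeAC subee// add0e.
have /ge0_integral_eq0P - /(_ md d0E) := d_int0.
by apply: aeS => x [] /eqP; rewrite subr_eq0 => /eqP.
Qed.

End AlmostEverywhere.

(** * Null sets of product measures and their sections *)

Section FubiniNull.
Context {d1 d2 : measure_display} {T1 : measurableType d1} {T2 : measurableType d2}
  {R : realType}.
Variables (m1 : {sigma_finite_measure set T1 -> \bar R})
          (m2 : {sigma_finite_measure set T2 -> \bar R}).
Local Open Scope ereal_scope.

Lemma prod_null_xsectionP (A : set (T1 * T2)) : measurable A ->
  (m1 \x m2) A = 0 <-> {ae m1, forall x, m2 (xsection A x) = 0}.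
Proof.
move=> mA; rewrite /product_measure1; apply: ge0_integral_eq0P => //.
exact: measurable_fun_xsection.
Qed.

(** The product measure is defined through x-sections; Tonelli for indicators exchanges the
    roles. *)
Lemma prod_null_ysectionP (A : set (T1 * T2)) : measurable A ->
  (m1 \x m2) A = 0 <-> {ae m2, forall y, m1 (ysection A y) = 0}.
Proof.
move=> mA; rewrite /product_measure1.
have := indic_fubini_tonelli m1 m2 mA.
rewrite indic_fubini_tonelli_FE// indic_fubini_tonelli_GE// => ->.
by apply: ge0_integral_eq0P => //; exact: measurable_fun_ysection.
Qed.

Lemma ae_prod_xsection (P : T1 * T2 -> Prop) : {ae m1 \x m2, forall p, P p} ->
  {ae m1, forall x, {ae m2, forall y, P (x, y)}}.
Proof.
move=> [A [mA A0 PA]]; have /prod_null_xsectionP := A0 => /(_ mA).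
apply: aeS => x xA0; exists (xsection A x); split => //.
  exact: measurable_xsection.
by move=> y /= nP; rewrite xsectionE; exact: PA.
Qed.

Lemma ae_prod_ysection (P : T1 * T2 -> Prop) : {ae m1 \x m2, forall p, P p} ->
  {ae m2, forall y, {ae m1, forall x, P (x, y)}}.
Proof.
move=> [A [mA A0 PA]]; have /prod_null_ysectionP := A0 => /(_ mA).
apply: aeS => y yA0; exists (ysection A y); split => //.
  exact: measurable_ysection.
by move=> x /= nP; rewrite ysectionE; exact: PA.
Qed.

(** Measurability is essential: a nonmeasurable plane set can have only null sections without being
    null. *)
Lemma xsection_ae_prod (P : T1 * T2 -> Prop) : measurable [set p | P p] ->
  {ae m1, forall x, {ae m2, forall y, P (x, y)}} -> {ae m1 \x m2, forall p, P p}.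
Proof.
move=> mP aeP; exists (~` [set p | P p]); split => //; first exact: measurableC.
apply/prod_null_xsectionP; first exact: measurableC.
apply: aeS aeP => x xP; apply: measure_negligible; last first.
  by apply: negligibleS xP; rewrite xsectionE.
by apply: measurable_xsection; exact: measurableC.
Qed.

Lemma ysection_ae_prod (P : T1 * T2 -> Prop) : measurable [set p | P p] ->
  {ae m2, forall y, {ae m1, forall x, P (x, y)}} -> {ae m1 \x m2, forall p, P p}.
Proof.
move=> mP aeP; exists (~` [set p | P p]); split => //; first exact: measurableC.
apply/prod_null_ysectionP; first exact: measurableC.
apply: aeS aeP => y yP; apply: measure_negligible; last first.
  by apply: negligibleS yP; rewrite ysectionE.
by apply: measurable_ysection; exact: measurableC.
Qed.

End FubiniNull.

Section FubiniNull3.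
Context {d1 d2 d3 : measure_display} {T1 : measurableType d1} {T2 : measurableType d2}
  {T3 : measurableType d3} {R : realType}.
Variables (m1 : {sigma_finite_measure set T1 -> \bar R})
          (m2 : {sigma_finite_measure set T2 -> \bar R})
          (m3 : {sigma_finite_measure set T3 -> \bar R}).

(** The inner product must itself be sigma-finite to be a factor of the threefold product. Its cover
    consists of the products of the two covers, enumerated by [unpickle]. *)
Let sigma_finite_m12 : sigma_finite setT (m1 \x m2)%E.
Proof.
have [F FT Ffin] := sigma_finiteT m1; have [G GT Gfin] := sigma_finiteT m2.
exists (fun n => if unpickle n is Some ij then F (ij : nat * nat).1 `*` G ij.2 else set0).
  apply/seteqP; split=> // -[x y] _.
  have [i _ Fix] : (\bigcup_i F i) x by rewrite -FT.
  have [j _ Gjy] : (\bigcup_j G j) y by rewrite -GT.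
  by exists (pickle (i, j)) => //; rewrite pickleK.
move=> n; case: unpickle => [[i j]|] /=; last by rewrite measure0; split.
have [mF Foo] := Ffin i; have [mG Goo] := Gfin j; split; first exact: measurableX.
by rewrite product_measure1E// lte_mul_pinfty// ge0_fin_numE.
Qed.

Let m12 : {sigma_finite_measure set (T1 * T2)%type -> \bar R} :=
  HB.pack (m1 \x m2)%E (Measure_isSigmaFinite.Build _ _ _ (m1 \x m2)%E sigma_finite_m12).

Lemma ae_prod3_xyz (P : T1 * T2 * T3 -> Prop) :
  {ae ((m1 \x m2) \x m3)%E, forall p, P p} ->
  {ae m1, forall x, {ae m2, forall y, {ae m3, forall z, P (x, y, z)}}}.
Proof.
by move=> /(ae_prod_xsection m12 m3 P)/(ae_prod_xsection m1 m2).
Qed.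

Lemma ae_prod3_zyx (P : T1 * T2 * T3 -> Prop) :
  {ae ((m1 \x m2) \x m3)%E, forall p, P p} ->
  {ae m3, forall z, {ae m2, forall y, {ae m1, forall x, P (x, y, z)}}}.
Proof.
move=> /(ae_prod_ysection m12 m3 P); apply: aeS => z.
exact: (ae_prod_ysection m1 m2).
Qed.

(** The section of the cylinder at (x, y) is the section of [A] at x, so the exceptional pairs lie
    in a null set [Z] times the whole middle factor. *)
Lemma ae_prod3_13 (P : T1 * T3 -> Prop) : {ae (m1 \x m3)%E, forall p, P p} ->
  {ae ((m1 \x m2) \x m3)%E, forall p, P (p.1.1, p.2)}.
Proof.
move=> [A [mA A0 PA]]; exists [set p | A (p.1.1, p.2)].
have mB : measurable [set p : T1 * T2 * T3 | A (p.1.1, p.2)].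
  rewrite -[X in measurable X]setTI.
  apply: (_ : measurable_fun setT (fun q : (T1 * T2) * T3 => (q.1.1, q.2))) => //.
  apply: measurable_fun_pair => //.
  exact: (measurableT_comp measurable_fst measurable_fst).
split => //; last by move=> p /= nP; exact: PA.
apply/(prod_null_xsectionP m12 m3 _ mB).
have [Z [mZ Z0 ZA]] := iffLR (prod_null_xsectionP m1 m3 _ mA) A0.
exists (Z `*` setT); split; first exact: measurableX.
  by apply: (etrans (product_measure1E m1 m2 mZ (@measurableT _ T2)));
    rewrite [X in (X * _)%E](_ : _ = 0%E) ?mul0e.
move=> [x y] /= nz; split => //; apply: ZA => /= h; apply: nz; rewrite -[RHS]h.
by rewrite !xsectionE.
Qed.

Lemma fubini_tonelli3 (f : T1 * T2 * T3 -> \bar R) :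
  measurable_fun setT f -> (forall p, 0 <= f p)%E ->
  (\int[(m1 \x m2) \x m3]_p f p =
   \int[m1]_x \int[m2]_y \int[m3]_z f (x, y, z))%E.
Proof.
move=> mf f0; have := @fubini_tonelli1 _ _ _ _ _ m12 m3 f mf f0 => ->.
have := @fubini_tonelli1 _ _ _ _ _ m1 m2 (fubini_F m3 f).
apply; first exact: measurable_fun_fubini_tonelli_F.
by move=> q; apply: integral_ge0.
Qed.

End FubiniNull3.

(** * Iterated integrals over the unit interval and nested almost-everywhere statements *)

Section IteratedIntegral.
Context {R : realType}.
Notation mu := (@lebesgue_measure R).
Implicit Type s : nat -> R.

(** Almost-everywhere counterpart of [iint], by the same recursion and with the same tail of zeros,
    so that iterated integrals compare by induction without a product measure on sequences. *)
Fixpoint iae n (P : (nat -> R) -> Prop) : Prop :=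
  match n with
  | 0%N => P (fun=> 0)
  | k.+1 => {ae mu, forall x, I01 x -> iae k (fun s => P (scons x s))}
  end.

Lemma I01_0 : I01 (0 : R). Proof. by rewrite /I01/= in_itv/= lexx ler01. Qed.

Lemma I01_scons (x : R) s : I01 x -> (forall i, I01 (s i)) -> forall i, I01 (scons x s i).
Proof. by move=> Ix Is [|i]//=. Qed.

Lemma iint_ge0 n (f : (nat -> R) -> \bar R) :
  (forall s, (forall i, I01 (s i)) -> 0 <= f s)%E -> (0 <= iint n f)%E.
Proof.
elim: n f => [f f0|n IH f f0] /=; first by apply: f0 => _; exact: I01_0.
apply: integral_ge0 => x Ix; apply: IH => s Is; apply: f0.
exact: I01_scons.
Qed.

Lemma eq_iint n (f g : (nat -> R) -> \bar R) :
  (forall s, (forall i, I01 (s i)) -> f s = g s) -> iint n f = iint n g.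
Proof.
elim: n f g => [f g fg|n IH f g fg] /=; first by apply: fg => _; exact: I01_0.
apply: eq_integral => x /set_mem Ix; apply: IH => s Is; apply: fg.
exact: I01_scons.
Qed.

Lemma iae_all n (P : (nat -> R) -> Prop) :
  (forall s, (forall i, I01 (s i)) -> P s) -> iae n P.
Proof.
elim: n P => [P h|n IH P h] /=; first by apply: h => _; exact: I01_0.
by apply: aeW => x Ix; apply: IH => s Is; apply: h; exact: I01_scons.
Qed.

Lemma iae_app n (P Q : (nat -> R) -> Prop) :
  iae n (fun s => P s -> Q s) -> iae n P -> iae n Q.
Proof.
elim: n P Q => [P Q h|n IH P Q /= hPQ hP]; first exact: h.
apply: aeS (aeI _ _ _ hPQ hP) => x [PQ Px] Ix.
exact: IH (PQ Ix) (Px Ix).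
Qed.

Lemma iae_mono n (P Q : (nat -> R) -> Prop) :
  (forall s, (forall i, I01 (s i)) -> P s -> Q s) -> iae n P -> iae n Q.
Proof. by move=> PQ; apply: iae_app; exact: iae_all. Qed.

Lemma iae_and n (P Q : (nat -> R) -> Prop) :
  iae n P -> iae n Q -> iae n (fun s => P s /\ Q s).
Proof.
move=> nP nQ; apply: iae_app nQ; apply: iae_app nP.
by apply: iae_all => s _ Ps Qs.
Qed.

Lemma iae_forall n (I : finType) (P : I -> (nat -> R) -> Prop) :
  (forall i, iae n (P i)) -> iae n (fun s => forall i, P i s).
Proof.
move=> nP; suff h (r : seq I) : iae n (fun s => forall i, i \in r -> P i s).
  by apply: iae_mono (h (enum I)) => s _ Ps i; apply: Ps; rewrite mem_enum.
elim: r => [|i r IH]; first exact: iae_all.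
apply: iae_mono (iae_and _ _ _ (nP i) IH) => s _ [Pi Pr] j.
by rewrite inE => /predU1P[->//|/Pr].
Qed.

Lemma iae_coord n (A : R -> Prop) i : (i < n)%N ->
  {ae mu, forall x, I01 x -> A x} -> iae n (fun s => A (s i)).
Proof.
elim: n i => [//|n IH [_|i lin]] /= aeA.
  by apply: aeS aeA => x Ax Ix; apply: iae_all => s _; exact: Ax.
by apply: aeW => x Ix; exact: IH.
Qed.

(** The quantifiers follow the order of integration, whence i < j. *)
Lemma iae_pair n (A : R -> R -> Prop) i j : (i < j < n)%N ->
  {ae mu, forall x, I01 x -> {ae mu, forall y, I01 y -> A x y}} ->
  iae n (fun s => A (s i) (s j)).
Proof.
elim: n i j => [i j|n IH [|i] [|j]] /=; rewrite ?ltn0 ?andbF// => ijn aeA.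
  by apply: aeS aeA => x Ax Ix; apply: (iae_coord n (A x)) => //; exact: Ax.
by apply: aeW => x Ix; exact: IH.
Qed.

(** Rests on the comparison of integrals without measurability: the inner iterated integrals are
    never shown to be measurable. *)
Lemma ae_eq_iint n (f g : (nat -> R) -> \bar R) :
  (forall s, (forall i, I01 (s i)) -> 0 <= f s)%E ->
  (forall s, (forall i, I01 (s i)) -> 0 <= g s)%E ->
  iae n (fun s => f s = g s) -> iint n f = iint n g.
Proof.
elim: n f g => [//|n IH f g f0 g0 fg] /=.
have sc x s : I01 x -> (forall i, I01 (s i)) -> forall i, I01 (scons x s i) by exact: I01_scons.
apply: ge0_ae_eq_integral_gen.
- by move=> x Ix; apply: iint_ge0 => s Is; apply: f0; exact: sc.
- by move=> x Ix; apply: iint_ge0 => s Is; apply: g0; exact: sc.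
- apply: aeS fg => x fgx Ix; apply: IH.
  + by move=> s Is; apply: f0; exact: sc.
  + by move=> s Is; apply: g0; exact: sc.
  + exact: fgx.
Qed.

End IteratedIntegral.

(** * Lebesgue density and regularization of kernels *)

Section Density.
Context {R : realType}.
Notation mu := (@lebesgue_measure R).
Local Open Scope ereal_scope.

(** The ball has measure 2 / (n + 1), so [B] must fill more than 3/4 of it. A proportion above 1/2
    makes two such sets meet, one below 1 is attained at density points, and discrete radii keep the
    notion measurable. *)
Definition dens (B : set R) (y : R) := exists N : nat, forall n, (N <= n)%N ->
  (3 / 2 * n.+1%:R^-1)%:E < mu (B `&` ball y n.+1%:R^-1).

Lemma ae_dens (B : set R) : measurable B -> {ae mu, forall y, dens B y <-> B y}.
Proof.
move=> mB; apply: aeS (lebesgue_density mB) => y dB.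
have ratio (r : R) : (0 < r)%R ->
    mu (B `&` ball y r) * (mu (ball y r))^-1 = mu (B `&` ball y r) * ((r *+ 2)^-1)%:E.
  move=> r0; rewrite lebesgue_measure_ball ?ltW// inver ifF//.
  by apply/negbTE; rewrite mulrn_eq0/= gt_eqF.
have cvg_n (U : set (\bar R)) : nbhs (\1_B y)%:E U -> exists N : nat, forall n, (N <= n)%N ->
    U (mu (B `&` ball y n.+1%:R^-1) * ((n.+1%:R^-1 *+ 2)^-1)%:E).
  move=> /dB[e /= e0 eU].
  have [N Ne] : exists N : nat, (e^-1 < N%:R)%R.
    by exists (Num.bound e^-1); rewrite archi_boundP// invr_ge0 ltW.
  exists N => n Nn; have n0 : (0 < n.+1%:R^-1 :> R)%R by rewrite invr_gt0.
  have := eU (n.+1%:R^-1)%R; rewrite ratio//; apply => //.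
  rewrite /ball_/= sub0r normrN gtr0_norm// invf_plt ?posrE//.
  by rewrite (lt_le_trans Ne)// ler_nat ltnW.
have scale n (c : R) : (c%:E < mu (B `&` ball y n.+1%:R^-1) * ((n.+1%:R^-1 *+ 2)^-1)%:E)
    = ((c * (n.+1%:R^-1 *+ 2))%:E < mu (B `&` ball y n.+1%:R^-1)).
  by rewrite lte_pdivlMr// ?mulrn_wgt0// ?invr_gt0// EFinM.
split => [[N dN]|By].
  apply: contrapT => nBy.
  have := cvg_n [set x | x < (1 / 2)%:E]; rewrite indicE memNset//.
  case; first by apply: open_ereal_lt'; rewrite lte_fin divr_gt0.
  move=> N' dN'; have := dN _ (leq_maxl N N'); have /= := dN' _ (leq_maxr N N').
  set n := maxn N N'; rewrite lte_pdivrMr// => h1 h2.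
  have := lt_trans h2 h1; rewrite -EFinM lte_fin.
  have : (0 < n.+1%:R^-1 :> R)%R by rewrite invr_gt0.
  by clear; move: (n.+1%:R^-1)%R => z z0; rewrite -[(z *+ 2)%R]mulr_natl => ?; lra.
have := cvg_n [set x | (3 / 4)%:E < x]; rewrite indicE mem_set//.
case; first by apply: open_ereal_gt'; rewrite lte_fin/=; clear; lra.
move=> N dN; exists N => n /dN /=; rewrite scale.
have -> // : (3 / 4 * (n.+1%:R^-1 *+ 2) = 3 / 2 * n.+1%:R^-1 :> R)%R.
by clear; move: (n.+1%:R^-1)%R => z; rewrite -[(z *+ 2)%R]mulr_natl; lra.
Qed.

Lemma dens_mono (B C : set R) y : measurable B -> measurable C ->
  {ae mu, forall u, B u -> C u} -> dens B y -> dens C y.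
Proof.
move=> mB mC BC [N dN]; exists N => n /dN /lt_le_trans; apply.
have mb : measurable (ball y n.+1%:R^-1 : set R) by exact: measurable_ball.
have BC0 : mu (B `\` C) = 0.
  apply: measure_negligible; first exact: measurableD.
  by apply: negligibleS BC => u [Bu nCu] /= /(_ Bu).
apply: (@le_trans _ _ (mu ((C `&` ball y n.+1%:R^-1) `|` (B `\` C)))).
  apply: le_measure; rewrite ?inE.
  - exact: measurableI.
  - by apply: measurableU; [exact: measurableI|exact: measurableD].
  - move=> u [Bu bu]; have [Cu|nCu] := pselect (C u); first by left.
    by right.
apply: (le_trans (measureU2 mu (measurableI _ _ mC mb) (measurableD mB mC))).
by rewrite [X in _ + X](_ : _ = 0) ?adde0.
Qed.

(** In a common small ball each set fills more than 3/4, so the intersection has positive measure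
    and meets every set of full measure. *)
Lemma dens_meet (B C : set R) (P : R -> Prop) y : measurable B -> measurable C ->
  dens B y -> dens C y -> {ae mu, forall u, P u} -> exists u, [/\ B u, C u & P u].
Proof.
move=> mB mC [N dN] [N' dN'] aeP; apply: contrapT => nex.
have BC0 : mu (B `&` C) = 0.
  apply: measure_negligible; first exact: measurableI.
  by apply: negligibleS aeP => u [Bu Cu] /= Pu; apply: nex; exists u.
have := dN _ (leq_maxl N N'); have := dN' _ (leq_maxr N N').
set n := maxn N N'; set b := ball y n.+1%:R^-1 => h1 h2.
have mb : measurable (b : set R) by exact: measurable_ball.
have h3 : mu (B `&` b) <= mu ((B `\` C) `&` b).
  rewrite -[leRHS]adde0 -BC0.
  apply: (le_trans _ (measureU2 mu (measurableI _ _ (measurableD mB mC) mb) (measurableI _ _ mB mC))).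
  apply: le_measure; rewrite ?inE.
  - exact: measurableI.
  - by apply: measurableU; apply: measurableI => //; exact: measurableD.
  - by move=> u [Bu bu]; have [Cu|nCu] := pselect (C u); [right|left].
have h4 : mu ((B `\` C) `&` b) + mu (C `&` b) <= mu b.
  rewrite -measureU.
  - apply: le_measure; rewrite ?inE//.
      by apply: measurableU; apply: measurableI => //; exact: measurableD.
    by move=> u [] [].
  - by apply: measurableI => //; exact: measurableD.
  - exact: measurableI.
  - by rewrite -subset0 => u [[[_ nC] _] [/nC]].
move: h4; rewrite leNgt => /negP; apply.
apply: (lt_le_trans _ (leeD h3 (lexx _))); apply: le_lt_trans (lteD h2 h1).
rewrite /b lebesgue_measure_ball ?invr_ge0// -EFinD lee_fin.
have : (0 < n.+1%:R^-1 :> R)%R by rewrite invr_gt0.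
by clear; move: (n.+1%:R^-1)%R => z z0; rewrite -[(z *+ 2)%R]mulr_natl; lra.
Qed.

(** For each radius the measure involved is that of a section of [E' n], a measurable function of
    the pair; countable unions and intersections remain. *)
Lemma measurable_dens (E : set (R * R)) : measurable E ->
  measurable [set p : R * R | dens [set z | E (p.1, z)] p.2].
Proof.
move=> mE.
pose E' n := [set q : (R * R) * R | E (q.1.1, q.2) /\ ball q.1.2 n.+1%:R^-1 q.2].
have mE' n : measurable (E' n).
  apply: measurableI.
    rewrite -[X in measurable X]setTI.
    apply: (_ : measurable_fun setT (fun q : (R * R) * R => (q.1.1, q.2))) => //.
    apply: measurable_fun_pair => //.
    exact: (measurableT_comp measurable_fst measurable_fst).
  have mf : measurable_fun setT (fun q : (R * R) * R => `|q.1.2 - q.2|%R).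
    apply: measurableT_comp => //; apply: measurable_funB => //.
    exact: (measurableT_comp measurable_snd measurable_fst).
  have := mf measurableT `]-oo, n.+1%:R^-1%R[%classic (measurable_itv _).
  rewrite setTI; congr measurable; by apply/seteqP; split=> q /=; rewrite in_itv/=; exact.
have -> : [set p : R * R | dens [set z | E (p.1, z)] p.2] =
    \bigcup_N \bigcap_(n in [set n | (N <= n)%N])
      [set p | (3 / 2 * n.+1%:R^-1)%:E < (mu \o xsection (E' n)) p].
  apply/seteqP; split=> [p [N dN]|p [N _ dN]].
    by exists N => // n /= /dN; rewrite xsectionE.
  by exists N => n /dN /=; rewrite xsectionE.
apply: bigcup_measurable => N _; apply: bigcap_measurable => [|n _]; first by exists N => /=.
have := measurable_fun_xsection mu (mE' n) measurableT
  (emeasurable_itv `](3 / 2 * n.+1%:R^-1)%:E, +oo[).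
rewrite setTI; congr measurable; apply/seteqP; split=> p /=; rewrite in_itv/= ?andbT//.
Qed.

End Density.

Lemma measurable_iff (d : measure_display) (T : measurableType d) (P Q : set T) :
  measurable P -> measurable Q -> measurable [set p | P p <-> Q p].
Proof.
move=> mP mQ.
have -> : [set p | P p <-> Q p] = (P `&` Q) `|` (~` P `&` ~` Q).
  apply/seteqP; split=> p /=.
    move=> [PQ QP]; have [Pp|nPp] := pselect (P p); first by left; split => //; exact: PQ.
    by right; split => // /QP.
  by case=> [[Pp Qp]|[nPp nQp]]; split.
apply: measurableU; first exact: measurableI.
by apply: measurableI; exact: measurableC.
Qed.

(* [lebesgue_measure] with its carrier and structure fixed: on products of the
   bare [R] the sigma-finite structure is not inferred. *)
Definition leb {R : realType} :
  {sigma_finite_measure set (measurableTypeR R) -> \bar R} := @lebesgue_measure R.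

Section Relations.
Context {R : realType}.
Local Notation TR := (measurableTypeR R).
Local Notation mu := (@leb R).
Local Notation mu2 := (@leb R \x @leb R)%E.
Implicit Types E : set (TR * TR).

Lemma measurable_section_l E x : measurable E -> measurable [set z | E (x, z)].
Proof. by move=> mE; have := measurable_xsection x mE; rewrite xsectionE. Qed.

Lemma measurable_section_r E y : measurable E -> measurable [set z | E (z, y)].
Proof. by move=> mE; have := measurable_ysection y mE; rewrite ysectionE. Qed.

Lemma measurable_preimage_swap E : measurable E -> measurable [set p | E (p.2, p.1)].
Proof.
move=> mE; have := @measurable_swap _ _ TR TR measurableT E mE.
by rewrite setTI.
Qed.

Lemma measurable_dens_r E : measurable E ->
  measurable [set p : TR * TR | dens [set z | E (z, p.2)] p.1].
Proof.
by move=> /measurable_preimage_swap/measurable_dens/measurable_preimage_swap.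
Qed.

(** Density theorem on each section; measurability of the relation assembles the exceptional points
    into a null set of the plane. *)
Lemma ae_dens_l E : measurable E ->
  {ae mu2, forall p, dens [set z | E (p.1, z)] p.2 <-> E p}.
Proof.
move=> mE; apply: (xsection_ae_prod leb leb).
  by apply: measurable_iff => //; exact: measurable_dens.
apply: aeW => x; apply: aeS (ae_dens _ (measurable_section_l E x mE)) => y //.
Qed.

Lemma ae_dens_r E : measurable E ->
  {ae mu2, forall p, dens [set z | E (z, p.2)] p.1 <-> E p}.
Proof.
move=> mE; apply: (ysection_ae_prod leb leb).
  by apply: measurable_iff => //; exact: measurable_dens_r.
by apply: aeW => y; apply: aeS (ae_dens _ (measurable_section_r E y mE)) => x.
Qed.

End Relations.

(** * From transitivity almost everywhere to transitivity everywhere *)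

Section Regularization.
Context {R : realType}.
Local Notation TR := (measurableTypeR R).
Local Notation mu := (@leb R).
Local Notation mu2 := (@leb R \x @leb R)%E.
Variable W : TR -> TR -> R.
Hypothesis mW : measurable_fun setT (fun p : TR * TR => W p.1 p.2).
Hypothesis W01 : forall x y, 0 <= W x y <= 1.
Hypothesis W_sum : forall x y, W x y + W y x <= 1.
Hypothesis W_trans : {ae (mu2 \x mu)%E, forall p : (TR * TR) * TR,
  0 < W p.1.1 p.1.2 -> 0 < W p.1.2 p.2 -> W p.1.1 p.2 = 1}.

Let E0 : set (TR * TR) := [set p | 0 < W p.1 p.2].
Let E1 : set (TR * TR) := [set p | W p.1 p.2 = 1].

Let mE0 : measurable E0.
Proof.
have := mW measurableT `]0, +oo[%classic (measurable_itv _).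
rewrite setTI; congr measurable.
by apply/seteqP; split=> p /=; rewrite in_itv/= andbT.
Qed.

Let mE1 : measurable E1.
Proof.
have := mW measurableT [set 1] (measurable_set1 _).
by rewrite setTI.
Qed.

Let E1_E0 p : E1 p -> E0 p. Proof. by rewrite /E1 /E0/= => ->; exact: ltr01. Qed.

(* Arcs seen by Lebesgue density from both endpoints; unlike [0 < W x y] this
   is unaffected by changing W on a null set. *)
Let strong (E : set (TR * TR)) x y :=
  dens [set z | E (x, z)] y /\ dens [set z | E (z, y)] x.

(** What an endpoint of a path needs with respect to a generic u near the middle vertex: the first
    and last clauses serve the start of the path, the two others its end. *)
Definition regular_point x := [/\
  {ae mu, forall u, 0 < W x u -> {ae mu, forall v, 0 < W u v -> W x v = 1}},
  {ae mu, forall u, 0 < W u x -> {ae mu, forall v, 0 < W v u -> W v x = 1}},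
  {ae mu, forall u, 0 < W u x -> dens [set z | E0 (u, z)] x} &
  {ae mu, forall u, 0 < W x u -> dens [set z | E0 (z, u)] x}].

(** The first two clauses are Fubini sections of [W_trans], from the first and from the last
    variable; the other two are sections of the density theorem in the plane. *)
Let ae_regular : {ae mu, forall x, regular_point x}.
Proof.
have g1 : {ae mu, forall x, {ae mu, forall u, 0 < W x u ->
    {ae mu, forall v, 0 < W u v -> W x v = 1}}}.
  have := ae_prod3_xyz leb leb leb _ W_trans.
  apply: aeS => x; apply: aeS => u /= h Wxu; apply: aeS h => v /=; exact.
have g2 : {ae mu, forall x, {ae mu, forall u, 0 < W u x ->
    {ae mu, forall v, 0 < W v u -> W v x = 1}}}.
  have := ae_prod3_zyx leb leb leb _ W_trans; apply: aeS => x.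
  apply: aeS => u /= h Wux; apply: aeS h => v /= h ?.
  exact: h.
have g3 : {ae mu, forall x, {ae mu, forall u, 0 < W u x -> dens [set z | E0 (u, z)] x}}.
  have := ae_prod_ysection leb leb _ (ae_dens_l E0 mE0); apply: aeS => x.
  by apply: aeS => u /= [_ h].
have g4 : {ae mu, forall x, {ae mu, forall u, 0 < W x u -> dens [set z | E0 (z, u)] x}}.
  have := ae_prod_xsection leb leb _ (ae_dens_r E0 mE0); apply: aeS => x.
  by apply: aeS => u /= [_ h].
apply: aeS (aeI _ _ _ (aeI _ _ _ g1 g2) (aeI _ _ _ g3 g4)) => x.
by move=> [[? ?] [? ?]]; split.
Qed.

(** For u as given by [dens_meet], regularity of z makes z a density point of the out-neighbourhood
    of u, and regularity of x gives W x v = 1 for almost every v in it; hence z is a density point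
    of the v with W x v = 1. The claim at x is symmetric. *)
Let strong_trans x y z : regular_point x -> regular_point z ->
  strong E0 x y -> strong E0 y z -> strong E1 x z.
Proof.
move=> [g1x _ _ g4x] [_ g2z g3z _] [xy _] [_ yz].
have [u [xu uz [[h1 h4] [h2 h3]]]] := dens_meet _ _ _ _
  (measurable_section_l _ x mE0) (measurable_section_r _ z mE0) xy yz
  (aeI _ _ _ (aeI _ _ _ g1x g4x) (aeI _ _ _ g2z g3z)).
split.
- apply: dens_mono (h3 uz); first exact: measurable_section_l.
    exact: measurable_section_l.
  exact: h1.
- apply: dens_mono (h4 xu); first exact: measurable_section_r.
    exact: measurable_section_r.
  exact: h2.
Qed.

Let strongS x y : strong E1 x y -> strong E0 x y.
Proof.
move=> [h1 h2]; split.
- apply: dens_mono h1; [exact: measurable_section_l|exact: measurable_section_l|].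
  by apply: aeW => u /E1_E0.
- apply: dens_mono h2; [exact: measurable_section_r|exact: measurable_section_r|].
  by apply: aeW => u /E1_E0.
Qed.

(** Otherwise some u near x would have W x u = W u x = 1, against [W_sum]. *)
Let strong1_irr x : ~ strong E1 x x.
Proof.
move=> [h1 h2].
have [u [xu ux _]] := dens_meet _ _ (fun=> True) _
  (measurable_section_l _ x mE1) (measurable_section_r _ x mE1) h1 h2
  (aeW _ (fun=> I)).
move: xu ux; rewrite /E1/= => xu ux; have := W_sum x u; rewrite xu ux; lra.
Qed.

Let mstrong E : measurable E -> measurable [set p : TR * TR | strong E p.1 p.2].
Proof.
by move=> mE; apply: measurableI; [exact: measurable_dens|exact: measurable_dens_r].
Qed.

Lemma kernel_regularization : exists W' : TR -> TR -> R,
  [/\ measurable_fun setT (fun p : TR * TR => W' p.1 p.2),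
      forall x y, 0 <= W' x y <= 1,
      (forall x y, W' x y + W' y x <= 1) /\ (forall x, W' x x = 0),
      forall x y z, 0 < W' x y -> 0 < W' y z -> W' x z = 1 &
      {ae mu2, forall p, W' p.1 p.2 = W p.1 p.2}].
Proof.
have [Z [mZ Z0 regZ]] := ae_regular.
have regP x : ~ Z x -> regular_point x by move=> nZ; apply: contrapT => /regZ.
pose G2 : set (TR * TR) := [set p | ~ Z p.1 /\ ~ Z p.2].
have mG2 : measurable G2.
  have -> : G2 = (~` Z) `*` (~` Z) by [].
  by apply: measurableX; exact: measurableC.
(* Being strong for [E1] does not determine W at the pair itself, so the value is forced to 1 on
   [K1]. Removing these pairs from [K2] makes the two sets disjoint; on [K2] the kernel keeps its
   value, which is below 1. *)
pose K1 := G2 `&` [set p | strong E1 p.1 p.2].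
pose K2 := (G2 `&` [set p | strong E0 p.1 p.2]) `\` ([set p | strong E1 p.1 p.2] `|` E1).
have mK1 : measurable K1 by apply: measurableI => //; exact: mstrong.
have mK2 : measurable K2.
  apply: measurableD; first by apply: measurableI => //; exact: mstrong.
  by apply: measurableU => //; exact: mstrong.
pose W' x y : R := \1_K1 (x, y) + \1_K2 (x, y) * W x y.
have W'1 x y : K1 (x, y) -> W' x y = 1.
  move=> K; rewrite /W' !indicE mem_set// memNset ?mul0r ?addr0//.
  by move=> [_]; apply; left; case: K.
have W'2 x y : K2 (x, y) -> W' x y = W x y.
  move=> K; rewrite /W' !indicE memNset; last first.
    by move=> [_ s]; case: K => _; apply; left.
  by rewrite mem_set// mul1r add0r.
have W'0 x y : ~ K1 (x, y) -> ~ K2 (x, y) -> W' x y = 0.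
  by move=> nK1 nK2; rewrite /W' !indicE !memNset// mul0r addr0.
have W'01 x y : 0 <= W' x y <= 1.
  have [K|nK1] := pselect (K1 (x, y)); first by rewrite W'1// ler01 lexx.
  have [K|nK2] := pselect (K2 (x, y)); first by rewrite W'2.
  by rewrite W'0// lexx ler01.
have W'pos x y : 0 < W' x y -> [/\ ~ Z x, ~ Z y & strong E0 x y].
  have [[[? ?] s]|nK1] := pselect (K1 (x, y)); first by split => //; exact: strongS.
  have [[[[? ?] s] _]|nK2] := pselect (K2 (x, y)); first by split.
  by rewrite W'0// ltxx.
have W'tr x y z : 0 < W' x y -> 0 < W' y z -> W' x z = 1.
  move=> /W'pos[Zx Zy xy] /W'pos[_ Zz yz]; apply: W'1; split => //.
  by apply: (strong_trans x y z) => //; exact: regP.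
(* A positive value at (x, x) would compose with itself to a strong [E1] loop. *)
have W'irr x : W' x x = 0.
  apply/eqP; rewrite eq_le; have /andP[-> _] := W'01 x x; rewrite andbT leNgt.
  apply/negP => /W'pos[Zx _ s]; apply: (strong1_irr x).
  by apply: (strong_trans x x x) => //; exact: regP.
exists W'; split => //.
- apply: measurable_funD; first exact: measurable_indic.
  by apply: measurable_funM => //; exact: measurable_indic.
(* Opposite positive values would force W' x x = 1, so at most one of the two is nonzero. *)
- split => // x y; have /andP[xy0 xy1] := W'01 x y; have /andP[yx0 yx1] := W'01 y x.
  have [xy|xy] := ltP 0 (W' x y); last by lra.
  have [yx|yx] := ltP 0 (W' y x); last by lra.
  by have := W'tr x y x xy yx; rewrite W'irr => /eqP; rewrite eq_sym oner_eq0.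
have aeZ : {ae mu, forall x, ~ Z x}.
  by exists Z; split => // x /= /contrapT.
have aeG2 : {ae mu2, forall p, G2 p}.
  apply: (xsection_ae_prod leb leb) => //; apply: (aeS _ _ _ _ aeZ) => x Zx; apply: (aeS _ _ _ _ aeZ) => y Zy.
  by split.
apply: aeS (aeI _ _ _ aeG2 (aeI _ _ _
  (aeI _ _ _ (ae_dens_l _ mE0) (ae_dens_r _ mE0))
  (aeI _ _ _ (ae_dens_l _ mE1) (ae_dens_r _ mE1)))) => -[x y] [Gp [[l0 r0] [l1 r1]]] /=.
have [K|nK1] := pselect (K1 (x, y)).
  by rewrite W'1//; case: K => _ [/l1].
have [K|nK2] := pselect (K2 (x, y)); first by rewrite W'2.
(* At a generic pair a positive W is strong for [E0], and strong for [E1] if W = 1, which puts the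
   pair in [K1] or [K2]. *)
rewrite W'0//; apply/eqP; rewrite eq_le; have /andP[-> _] := W01 x y; rewrite andTb leNgt.
apply/negP => Wpos; apply: nK2; split; first by split => //; split; [exact/l0|exact/r0].
by case=> [s|W1]; apply: nK1; split => //; split; [exact/l1|exact/r1].
Qed.

End Regularization.

(** * Quintuples *)

Section Quintuples.
Variable R : realType.
Implicit Types (Q : quintuple R) (s : nat -> R).
Local Notation TR := (measurableTypeR R).

Lemma is_quintuple_facts Q : is_quintuple Q -> forall x y, I01 x -> I01 y ->
  [/\ 0 <= W00 Q x y, 0 <= W10 Q x y, 0 <= W10 Q y x, 0 <= W11 Q x y &
      W01 Q x y = W10 Q y x /\ W00 Q x y + W10 Q y x + W10 Q x y + W11 Q x y = 1].
Proof.
move=> [_ [_ [b [su [sy _]]]]] x y Ix Iy.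
have /andP[h00 _] := b false false x y Ix Iy; have /andP[h10 _] := b true false x y Ix Iy.
have /andP[h10' _] := b true false y x Iy Ix; have /andP[h11 _] := b true true x y Ix Iy.
have E : W01 Q x y = W10 Q y x := sy false true x y Ix Iy.
split => //; split => //; have := su x y Ix Iy; rewrite !big_bool/= E; lra.
Qed.

Lemma pW_TT Q x y : pW Q true true x y = W11 Q x y.
Proof. by rewrite /pW big_mkcond big_bool/= big_mkcond big_bool/= !addr0. Qed.

Lemma pW_TF Q x y : pW Q true false x y = W11 Q x y + W10 Q x y.
Proof. by rewrite /pW big_mkcond big_bool/= big_bool/= !addr0. Qed.

Lemma pW_FF Q x y : is_quintuple Q -> I01 x -> I01 y -> pW Q false false x y = 1.
Proof.
move=> [_ [_ [_ [su _]]]] Ix Iy; exact: su.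
Qed.

Lemma cond_sub_C1 Q s : cond_sub Q C1 s = qw Q (s 0%N).
Proof.
rewrite /cond_sub; under [X in _ * X]eq_bigr do rewrite big_mkcond.
by rewrite !(big_ord_recl, big_ord0)/= /bump/= !mulr1.
Qed.

Lemma cond_sub_C2 Q s : cond_sub Q C2 s = W11 Q (s 0%N) (s 1%N).
Proof.
rewrite /cond_sub; under [X in _ * X]eq_bigr do rewrite big_mkcond.
by rewrite !(big_ord_recl, big_ord0)/= /bump/= ?eqxx !mulr1 !mul1r pW_TT.
Qed.

Lemma cond_sub_P2 Q s : is_quintuple Q -> (forall i, I01 (s i)) ->
  cond_sub Q P2 s = (W11 Q (s 0%N) (s 1%N) + W10 Q (s 0%N) (s 1%N)) *
                    (W11 Q (s 1%N) (s 2%N) + W10 Q (s 1%N) (s 2%N)).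
Proof.
move=> qQ Is; rewrite /cond_sub; under [X in _ * X]eq_bigr do rewrite big_mkcond.
by rewrite !(big_ord_recl, big_ord0)/= /bump/= !mulr1 !mul1r !pW_TF pW_FF// mulr1.
Qed.

Lemma cond_sub_T3 Q s :
  cond_sub Q T3 s = (W11 Q (s 0%N) (s 1%N) + W10 Q (s 0%N) (s 1%N)) *
                    (W11 Q (s 1%N) (s 2%N) + W10 Q (s 1%N) (s 2%N)) *
                    (W11 Q (s 0%N) (s 2%N) + W10 Q (s 0%N) (s 2%N)).
Proof.
rewrite /cond_sub; under [X in _ * X]eq_bigr do rewrite big_mkcond.
rewrite !(big_ord_recl, big_ord0)/= /bump/= !mulr1 !mul1r !pW_TF.
by rewrite mulrAC.
Qed.

Lemma cond_sub_ge0 Q F s : is_quintuple Q -> (forall i, I01 (s i)) ->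
  0 <= cond_sub Q F s.
Proof.
move=> [_ [_ [b [_ [_ w]]]]] Is; apply: mulr_ge0; apply: prodr_ge0 => i _.
  by case: ifP => // _; have [->|->] := w _ (Is i).
apply: prodr_ge0 => j _; apply: sumr_ge0 => al _; apply: sumr_ge0 => be _.
by have /andP[] := b al be _ _ (Is i) (Is j).
Qed.

Lemma iint0 n : iint n (fun=> 0 : \bar R)%E = 0%E.
Proof. by elim: n => [//|n IH] /=; apply: integral0_eq => x _; exact: IH. Qed.

(** The conditional probabilities of [P2] and [T3] agree at every point: the extra factor is 1
    whenever the two others are positive. *)
Lemma strict_kernel_transitive_limit Q Gam : represents Q Gam ->
  (forall x, I01 x -> qw Q x = 0) ->
  (forall x y, I01 x -> I01 y -> W11 Q x y = 0) ->
  (forall x y z, I01 x -> I01 y -> I01 z ->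
     0 < W10 Q x y -> 0 < W10 Q y z -> W10 Q x z = 1) ->
  transitive_limit R Gam.
Proof.
move=> [qQ rep] w0 W110 tr.
have val0 F : (forall s, (forall i, I01 (s i)) -> cond_sub Q F s = 0) ->
    Gam (Some F) = 0.
  move=> F0; apply/EFin_inj; rewrite rep /prob_sub; apply: (etrans _ (iint0 (dn F).+1)).
  by apply: eq_iint => s Is; rewrite F0.
split.
- by apply: val0 => s Is; rewrite cond_sub_C1 w0.
- by apply: val0 => s Is; rewrite cond_sub_C2 W110.
- apply/EFin_inj; rewrite !rep /prob_sub; apply: eq_iint => s Is.
  rewrite cond_sub_P2// cond_sub_T3 !W110// !add0r; congr EFin.
  have [_ h01 _ _ _] := is_quintuple_facts Q qQ _ _ (Is 0%N) (Is 1%N).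
  have [_ h12 _ _ _] := is_quintuple_facts Q qQ _ _ (Is 1%N) (Is 2%N).
  move: h01; rewrite le_eqVlt => /predU1P[<-|p01]; first by rewrite !mul0r.
  move: h12; rewrite le_eqVlt => /predU1P[<-|p12]; first by rewrite mulr0 mul0r.
  by rewrite (tr _ _ _ _ _ _ p01 p12)// mulr1.
Qed.

Lemma ae_eq_prob_sub Q Q' F : is_quintuple Q -> is_quintuple Q' ->
  {ae @leb R, forall x, I01 x -> qw Q x = qw Q' x} ->
  {ae @leb R, forall x, I01 x -> {ae @leb R, forall y, I01 y ->
     forall a b, Wab Q a b x y = Wab Q' a b x y}} ->
  prob_sub Q F = prob_sub Q' F.
Proof.
move=> qQ qQ' aew aeW_; apply: ae_eq_iint.
- by move=> s Is; rewrite lee_fin cond_sub_ge0.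
- by move=> s Is; rewrite lee_fin cond_sub_ge0.
have loops : iae (dn F).+1 (fun s => forall i : 'I_(dn F).+1, qw Q (s i) = qw Q' (s i)).
  by apply: iae_forall => i; exact: (iae_coord _ (fun x => qw Q x = qw Q' x)).
have pairs : iae (dn F).+1 (fun s => forall p : 'I_(dn F).+1 * 'I_(dn F).+1,
    (p.1 < p.2)%N -> forall a b, Wab Q a b (s p.1) (s p.2) = Wab Q' a b (s p.1) (s p.2)).
  apply: iae_forall => -[i j]; have [ij|/negPf nij] := boolP (i < j)%N; last first.
    by apply: iae_all => s _; rewrite /= ?nij.
  apply: (iae_mono _ (fun s => forall a b, Wab Q a b (s i) (s j) = Wab Q' a b (s i) (s j))).
    by move=> s _ h _; exact: h.
  apply: (iae_pair _ (fun x y => forall a b, Wab Q a b x y = Wab Q' a b x y)) => //.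
  by rewrite ij/=.
apply: iae_mono (iae_and _ _ _ loops pairs) => s _ [hl hp].
congr EFin; rewrite /cond_sub; congr (_ * _).
  by apply: eq_bigr => i _; rewrite hl.
apply: eq_bigr => i _; apply: eq_bigr => j ij.
by apply: eq_bigr => al _; apply: eq_bigr => be _; exact: (hp (i, j)).
Qed.

Section Regularize.
Variables (Q : quintuple R) (qQ : is_quintuple Q).
Hypothesis qw0 : {ae @leb R, forall x, I01 x -> qw Q x = 0}.
Hypothesis W110 : {ae (@leb R \x @leb R)%E, forall p, I01sq p -> W11 Q p.1 p.2 = 0}.
Hypothesis W10tr : {ae ((@leb R \x @leb R) \x @leb R)%E, forall p : (TR * TR) * TR,
  I01 p.1.1 /\ I01 p.1.2 /\ I01 p.2 ->
  0 < W10 Q p.1.1 p.1.2 -> 0 < W10 Q p.1.2 p.2 -> W10 Q p.1.1 p.2 = 1}.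

(** Extended by 0 outside the unit square, since the regularization works on the whole line. *)
Let W (x y : TR) : R := ((fun p : TR * TR => W10 Q p.1 p.2) \_ I01sq) (x, y).

Let mI01sq : measurable (I01sq : set (TR * TR)).
Proof. by apply: measurableX; exact: measurable_itv. Qed.

Let WE x y : I01 x -> I01 y -> W x y = W10 Q x y.
Proof. by move=> Ix Iy; rewrite /W patchE mem_set. Qed.

Let W_out x y : ~ (I01 x /\ I01 y) -> W x y = 0.
Proof. by move=> n; rewrite /W patchE memNset. Qed.

Let W_pos x y : 0 < W x y -> [/\ I01 x, I01 y & 0 < W10 Q x y].
Proof.
have [[Ix Iy]|n] := pselect (I01 x /\ I01 y); last by rewrite W_out// ltxx.
by rewrite WE.
Qed.

Let mW : measurable_fun setT (fun p : TR * TR => W p.1 p.2).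
Proof.
have [mQ _] := qQ; have := mQ true false => /= mQ10.
have -> : (fun p : TR * TR => W p.1 p.2) = (fun p : TR * TR => W10 Q p.1 p.2) \_ I01sq.
  by apply/funext => -[x y].
by apply/(measurable_restrict _ mI01sq measurableT); rewrite setTI.
Qed.

Lemma strict_kernel_exists : exists Q' : quintuple R,
  [/\ is_quintuple Q', forall F, prob_sub Q F = prob_sub Q' F,
      (forall x, I01 x -> qw Q' x = 0) /\
      (forall x y, I01 x -> I01 y -> W11 Q' x y = 0),
      (forall x, I01 x -> W10 Q' x x = 0) &
      (forall x y z, I01 x -> I01 y -> I01 z ->
          0 < W10 Q' x y -> 0 < W10 Q' y z -> W10 Q' x z = 1)].
Proof.
have W01' x y : 0 <= W x y <= 1.
  have [[Ix Iy]|n] := pselect (I01 x /\ I01 y); last by rewrite W_out// lexx ler01.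
  rewrite WE//; have [? ? ? ? [_ ?]] := is_quintuple_facts Q qQ x y Ix Iy.
  by apply/andP; split => //; lra.
have Wsum x y : W x y + W y x <= 1.
  have [[Ix Iy]|n] := pselect (I01 x /\ I01 y).
    rewrite !WE//; have [? ? ? ? [_ ?]] := is_quintuple_facts Q qQ x y Ix Iy.
    lra.
  by rewrite W_out// W_out ?addr0//; move=> [? ?]; apply: n.
have Wtr : {ae ((@leb R \x @leb R) \x @leb R)%E, forall p : (TR * TR) * TR,
    0 < W p.1.1 p.1.2 -> 0 < W p.1.2 p.2 -> W p.1.1 p.2 = 1}.
  apply: aeS W10tr => -[[x y] z] /= h /W_pos[Ix Iy xy] /W_pos[_ Iz yz].
  by rewrite WE// h.
have [W' [mW' W'01 [W'sum W'irr] W'tr W'E]] :=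
  kernel_regularization W mW W01' Wsum Wtr.
have mW't : measurable_fun setT (fun p : TR * TR => W' p.2 p.1).
  exact: (measurableT_comp mW' (@measurable_swap _ _ TR TR)).
(* All components are rebuilt from [W'], so that the symmetry relations hold everywhere; the bound
   on W' x y + W' y x makes the remainder [W00] nonnegative. *)
pose Q' := @Quintuple R (fun x y => 1 - W' x y - W' y x) (fun x y => W' y x)
  (fun x y => W' x y) (fun _ _ => 0) (fun=> 0).
have qQ' : is_quintuple Q'.
  split; [|split; [|split; [|split; [|split]]]].
  - move=> a b; apply: (measurable_funS measurableT (@subsetT _ _)).
    case: a; case: b => /=; [exact: measurable_cst|exact: mW'|exact: mW't|].
    by apply: measurable_funB => //; apply: measurable_funB.
  - exact: measurable_cst.
  - move=> a b x y _ _; have /andP[? ?] := W'01 x y; have /andP[? ?] := W'01 y x.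
    have := W'sum x y.
    by case: a; case: b => /= ?; apply/andP; split; lra.
  - by move=> x y _ _; rewrite !big_bool/=; lra.
  - by move=> a b x y _ _; case: a; case: b => //=; lra.
  - by move=> x _; left.
exists Q'; split => //; last by move=> x y z _ _ _; exact: W'tr.
move=> F; apply: ae_eq_prob_sub => //.
have h1 := ae_prod_xsection _ _ _ W110.
(* [W'] is compared with [W] at (x, y) and at (y, x), hence sections in both directions. *)
have h2 := ae_prod_xsection _ _ _ W'E.
have h3 := ae_prod_ysection _ _ _ W'E.
apply: aeS (aeI _ _ _ h1 (aeI _ _ _ h2 h3)) => x [a1 [a2 a3]] Ix.
apply: aeS (aeI _ _ _ a1 (aeI _ _ _ a2 a3)) => y /= [b1 [b2 b3]] Iy.
have {}b1 := b1 (conj Ix Iy); rewrite WE// in b2; rewrite WE// in b3.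
have [? ? ? ? [E01 E]] := is_quintuple_facts Q qQ x y Ix Iy.
by case; case => /=; rewrite ?b1 ?b2 ?b3 ?E01//; lra.
Qed.

End Regularize.

End Quintuples.

(** * Consequences of the density identities for a representing kernel *)

Section KernelOfLimit.
Variable R : realType.
Local Notation TR := (measurableTypeR R).
Local Notation mu := (@leb R).

(** [iint] integrates over the unit interval, the product theorems over the whole line; functions
    extended by 0 pass from one to the other. *)
Lemma integral_I01 (h : TR -> \bar R) : (forall x, ~ I01 x -> h x = 0)%E ->
  (\int[mu]_(x in I01) h x = \int[mu]_x h x)%E.
Proof.
move=> h0; rewrite integral_mkcond; apply: eq_integral => x _.
by rewrite patchE; case: ifPn => // /negP nx; rewrite h0// => Ix; apply: nx; exact: mem_set.
Qed.

Variables (Q : quintuple R) (Gam : DPt R).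
Hypothesis repQ : represents Q Gam.
Hypothesis Gtr : transitive_limit R Gam.

Let qQ : is_quintuple Q. Proof. by case: repQ. Qed.

Let mI01sq : measurable (I01sq : set (TR * TR)).
Proof. by apply: measurableX; exact: measurable_itv. Qed.

Let ext (f : TR -> TR -> R) (x y : TR) : R := ((fun p => f p.1 p.2) \_ I01sq) (x, y).

Let extE f x y : I01 x -> I01 y -> ext f x y = f x y.
Proof. by move=> Ix Iy; rewrite /ext patchE mem_set. Qed.

Let ext_out f x y : ~ (I01 x /\ I01 y) -> ext f x y = 0.
Proof. by move=> n; rewrite /ext patchE memNset. Qed.

Let mext f : measurable_fun I01sq (fun p : TR * TR => f p.1 p.2) ->
  measurable_fun setT (fun p : TR * TR => ext f p.1 p.2).
Proof.
move=> mf.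
have -> : (fun p : TR * TR => ext f p.1 p.2) = (fun p : TR * TR => f p.1 p.2) \_ I01sq.
  by apply/funext => -[x y].
by apply/(measurable_restrict _ mI01sq measurableT); rewrite setTI.
Qed.

Lemma transitive_limit_loops : {ae mu, forall x, I01 x -> qw Q x = 0}.
Proof.
pose w (x : TR) : R := (qw Q \_ I01) x.
have wE x : I01 x -> w x = qw Q x by move=> Ix; rewrite /w patchE mem_set.
have [_ [mq [_ [_ [_ wv]]]]] := qQ.
have w0 x : (0 <= (w x)%:E)%E.
  rewrite /w patchE lee_fin; case: ifPn => // /set_mem Ix.
  by have [->|->] := wv x Ix.
have mw : measurable_fun setT (fun x => (w x)%:E).
  apply/measurable_EFinP; apply/(measurable_restrict _ (measurable_itv _) measurableT).
  by rewrite setTI.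
have int0 : (\int[mu]_x (w x)%:E = 0)%E.
  rewrite -integral_I01; last by move=> x nx; rewrite /w patchE memNset.
  have [_ rep] := repQ; have [G1 _ _] := Gtr; have := rep C1; rewrite G1 => /esym rC1.
  apply: (etrans _ rC1).
  transitivity (iint 1 (fun s => (w (s 0%N))%:E)) => //.
  by apply: eq_iint => s Is; rewrite cond_sub_C1 wE.
have /ge0_integral_eq0P - /(_ mw w0) := int0.
by apply: aeS => x [wx] Ix; rewrite -wE.
Qed.

Lemma transitive_limit_W11 :
  {ae (mu \x mu)%E, forall p, I01sq p -> W11 Q p.1 p.2 = 0}.
Proof.
pose f := ext (W11 Q).
have [mQ _] := qQ; have mf : measurable_fun setT (fun p : TR * TR => (f p.1 p.2)%:E).
  by apply/measurable_EFinP; apply: mext; exact: (mQ true true).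
have f0 p : (0 <= (f p.1 p.2)%:E)%E.
  rewrite lee_fin; have [[Ix Iy]|n] := pselect (I01 p.1 /\ I01 p.2).
    by rewrite /f extE//; have [] := is_quintuple_facts R Q qQ _ _ Ix Iy.
  by rewrite /f ext_out.
have int0 : (\int[mu \x mu]_p (f p.1 p.2)%:E = 0)%E.
  rewrite fubini_tonelli1// /fubini_F/=.
  have [_ rep] := repQ; have [_ G2 _] := Gtr; have := rep C2; rewrite G2 => /esym rC2.
  apply: (etrans _ rC2).
  transitivity (iint 2 (fun s => (f (s 0%N) (s 1%N))%:E)).
    rewrite /= -integral_I01; last first.
      by move=> x nx; apply: integral0_eq => y _; rewrite /f ext_out// => -[].
    apply: eq_integral => x _; rewrite -integral_I01// => y ny.
    by rewrite /f ext_out// => -[].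
  by apply: eq_iint => s Is; rewrite cond_sub_C2 /f extE.
have /ge0_integral_eq0P - /(_ mf f0) := int0.
by apply: aeS => -[x y] [fx] [Ix Iy]; rewrite -fx /f extE.
Qed.

(** The functions [g] and [h] integrate to the densities of [P2] and [T3]. Equal finite integrals
    and h <= g force h = g almost everywhere, and g cancels where both arcs have positive weight. *)
Lemma transitive_limit_W10 :
  {ae ((mu \x mu) \x mu)%E, forall p : (TR * TR) * TR,
    I01 p.1.1 /\ I01 p.1.2 /\ I01 p.2 ->
    0 < W10 Q p.1.1 p.1.2 -> 0 < W10 Q p.1.2 p.2 ->
    W11 Q p.1.1 p.2 + W10 Q p.1.1 p.2 = 1}.
Proof.
pose f := ext (fun x y => W11 Q x y + W10 Q x y).
have [mQ _] := qQ; have mf : measurable_fun setT (fun p : TR * TR => f p.1 p.2).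
  by apply: mext; apply: measurable_funD; [exact: (mQ true true)|exact: (mQ true false)].
have f01 x y : 0 <= f x y <= 1.
  have [[Ix Iy]|n] := pselect (I01 x /\ I01 y); last by rewrite /f ext_out// lexx ler01.
  rewrite /f extE//; have [? ? ? ? [_ ?]] := is_quintuple_facts R Q qQ _ _ Ix Iy.
  by apply/andP; split; lra.
pose g (p : (TR * TR) * TR) : R := f p.1.1 p.1.2 * f p.1.2 p.2.
pose h (p : (TR * TR) * TR) : R := g p * f p.1.1 p.2.
have m12 : measurable_fun setT (fun p : (TR * TR) * TR => f p.1.1 p.1.2).
  exact: (measurableT_comp mf measurable_fst).
have m23 : measurable_fun setT (fun p : (TR * TR) * TR => f p.1.2 p.2).
  apply: (measurableT_comp mf (_ : measurable_fun setT (fun p : (TR * TR) * TR => (p.1.2, p.2)))).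
  apply: measurable_fun_pair => //.
  exact: (measurableT_comp measurable_snd measurable_fst).
have m13 : measurable_fun setT (fun p : (TR * TR) * TR => f p.1.1 p.2).
  apply: (measurableT_comp mf (_ : measurable_fun setT (fun p : (TR * TR) * TR => (p.1.1, p.2)))).
  apply: measurable_fun_pair => //.
  exact: (measurableT_comp measurable_fst measurable_fst).
have mg : measurable_fun setT g by exact: measurable_funM.
have mh : measurable_fun setT h by exact: measurable_funM.
have g0 p : 0 <= g p.
  have /andP[? _] := f01 p.1.1 p.1.2; have /andP[? _] := f01 p.1.2 p.2.
  exact: mulr_ge0.
have hg p : 0 <= h p <= g p.
  have /andP[? ?] := f01 p.1.1 p.2.
  by rewrite /h mulr_ge0//= ler_piMr.
(* Domination by [g] makes [e] vanish off the unit cube; [g] and [h] are both instances. *)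
have iintE (e : (TR * TR) * TR -> R) : measurable_fun setT e ->
    (forall p, 0 <= e p <= g p) ->
    (\int[(mu \x mu) \x mu]_p (e p)%:E = iint 3 (fun s => (e (s 0%N, s 1%N, s 2%N))%:E))%E.
  move=> me eg.
  have e_out x y z : ~ (I01 x /\ I01 y /\ I01 z) -> e (x, y, z) = 0.
    move=> n; have /andP[e0 eg0] := eg (x, y, z); apply/le_anti; rewrite e0 andbT.
    apply: (le_trans eg0); rewrite /g/= le_eqVlt; apply/orP; left; apply/eqP.
    have [[Ix Iy]|nxy] := pselect (I01 x /\ I01 y); last by rewrite /f ext_out ?mul0r.
    by rewrite [X in _ * X]/f ext_out ?mulr0// => -[_ Iz]; apply: n.
  rewrite fubini_tonelli3; [|exact/measurable_EFinP|by move=> p; rewrite lee_fin; have /andP[] := eg p].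
  rewrite /= -integral_I01; last first.
    move=> x nx; apply: integral0_eq => y _; apply: integral0_eq => z _.
    by rewrite e_out// => -[].
  apply: eq_integral => x _; rewrite -integral_I01; last first.
    move=> y ny; apply: integral0_eq => z _.
    by rewrite e_out// => -[_ []].
  apply: eq_integral => y _; rewrite -integral_I01// => z nz.
  by rewrite e_out// => -[_ []].
have [_ rep] := repQ; have [_ _ G3] := Gtr.
have intg : (\int[(mu \x mu) \x mu]_p (g p)%:E = (Gam (Some P2))%:E)%E.
  have gg p : 0 <= g p <= g p by rewrite g0 lexx.
  apply: (etrans (iintE g mg gg)); apply: (etrans _ (esym (rep P2))).
  by apply: eq_iint => s Is; rewrite cond_sub_P2// /g /f /= !extE.
have inth : (\int[(mu \x mu) \x mu]_p (h p)%:E = (Gam (Some P2))%:E)%E.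
  rewrite G3; apply: (etrans (iintE h mh hg)); apply: (etrans _ (esym (rep T3))).
  by apply: eq_iint => s Is; rewrite cond_sub_T3 /h /g /f /= !extE.
have : {ae ((mu \x mu) \x mu)%E, forall p, h p = g p}.
  apply: ae_eq_of_integral_eq => //; first by rewrite inth intg.
  by rewrite inth ltry.
apply: aeS => -[[x y] z] /= hgE [Ix [Iy Iz]] xy yz.
have [_ _ _ h11 _] := is_quintuple_facts R Q qQ _ _ Ix Iy.
have [_ _ _ h11' _] := is_quintuple_facts R Q qQ _ _ Iy Iz.
have gpos : 0 < g (x, y, z).
  by rewrite /g /f/= !extE// mulr_gt0// ltr_wpDl.
by apply: (mulfI (lt0r_neq0 gpos)); rewrite mulr1 -[RHS]hgE /h/= [f x z]extE.
Qed.

End KernelOfLimit.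

(** * The cycle of implications between the five conditions *)

Theorem theorem10p1 (R : realType) (Gam : DPt R) (Q : quintuple R) :
  Dinf Gam -> represents Q Gam ->
  [<->
    (* (i) *)
    Pinf Gam;
    (* (ii) *)
    (forall F : digraph, ~ is_poset F -> tind_lim_is F Gam 0);
    (* (iii) *)
    (tind_lim_is C1 Gam 0 /\ tind_lim_is C2 Gam 0 /\
     tind_lim_is C3 Gam 0 /\ tind_lim_is P2 Gam 0);
    (* (iv) *)
    ((@lebesgue_measure R).-negligible [set x | I01 x /\ qw Q x <> 0] /\
     ((@lebesgue_measure R \x @lebesgue_measure R)%E).-negligible
        [set p : R * R | I01sq p /\ W11 Q p.1 p.2 <> 0] /\
     (((@lebesgue_measure R \x @lebesgue_measure R) \x @lebesgue_measure R)%E).-negligible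
        [set p : (R * R) * R | (I01 p.1.1 /\ I01 p.1.2 /\ I01 p.2) /\
           0 < W10 Q p.1.1 p.1.2 /\ 0 < W10 Q p.1.2 p.2 /\ W10 Q p.1.1 p.2 < 1]);
    (* (v) *)
    (exists Q' : quintuple R, represents Q' Gam /\
       (forall x, I01 x -> qw Q' x = 0) /\
       (forall x y, I01 x -> I01 y -> W11 Q' x y = 0) /\
       (forall x, I01 x -> W10 Q' x x = 0) /\
       (forall x y z, I01 x -> I01 y -> I01 z ->
          0 < W10 Q' x y -> 0 < W10 Q' y z -> W10 Q' x z = 1))].
Proof.
move=> DGam repQ; have [qQ rep] := repQ; have [clD _] := DGam; tfae.
- by move=> [clP _] F; apply: transitive_tind_lim; exact: Pset_closure_transitive.
- move=> h; split; first by apply: h; exact: not_poset_C1.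
  split; first by apply: h; exact: not_poset_C2.
  by split; apply: h; [exact: not_poset_C3|exact: not_poset_P2].
- move=> [c1 [c2 [c3 p2]]]; have tr := tind_lim_transitive _ _ clD c1 c2 c3 p2.
  have h1 := transitive_limit_loops _ _ _ repQ tr.
  have h2 := transitive_limit_W11 _ _ _ repQ tr.
  have h3 := transitive_limit_W10 _ _ _ repQ tr.
  split; [|split].
  + by apply: negligibleS h1 => x [Ix wx] /= h; exact: wx (h Ix).
  + by apply: negligibleS h2 => p [Ip wp] /= h; exact: wp (h Ip).
  (* The null set of pairs for [W11] is lifted to triples, to turn W11 + W10 = 1 into W10 = 1 at (x,
     z). *)
  + have h2' : {ae ((@leb R \x @leb R) \x @leb R)%E, forall p,
        I01 p.1.1 -> I01 p.2 -> W11 Q p.1.1 p.2 = 0}.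
      have := ae_prod3_13 _ (@leb R) _ _ h2.
      by apply: aeS => p /= h Ix Iz; exact: h.
    apply: negligibleS (aeI _ _ _ h2' h3) => -[[x y] z] /= [[Ix [Iy Iz]] [xy [yz xz]]].
    move=> [h h']; have := h' (conj Ix (conj Iy Iz)) xy yz; rewrite (h Ix Iz) add0r => xz1.
    by rewrite xz1 ltxx in xz.
- move=> [h1 [h2 h3]].
  have [|||Q' [qQ' pQ' [w0 W0] irr tr]] := strict_kernel_exists R Q qQ.
  + by apply: negligibleS h1 => x /= /not_implyP.
  + by apply: negligibleS h2 => p /= /not_implyP.
  + apply: negligibleS h3 => -[[x y] z] /= /not_implyP[[Ix [Iy Iz]]].
    move=> /not_implyP[xy /not_implyP[yz nxz]]; split => //; split => //; split => //.
    have [? ? ? ? [_ ?]] := is_quintuple_facts R Q qQ x z Ix Iz.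
    by rewrite lt_neqAle; apply/andP; split; [exact/eqP|lra].
  exists Q'; split; last by split => //; split.
  by split => // F; rewrite rep pQ'.
- move=> [Q' [repQ' [w0 [W0 [_ tr]]]]]; apply: transitive_Pinf => //.
  exact: (strict_kernel_transitive_limit R Q').
Qed.
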